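(* Let $c\in(1,\infty)\setminus\mathbb{Z}$, $x\ge 1$, and let $a,q,k\in\mathbb{Z}$ with $1\le q\le x^{c}$ and $k\ge 1$. Then \[ N_{c}(x;a,q) = \frac{x}{q} + O\bigl(x^{1-\frac{k-c}{2^{k}-1}}q^{-\frac{1}{2^{k}-1}}\bigr), \] where the implicit constant depends only on $c$ and $k$.
   Context: For a real number $y$, $[y]$ denotes the largest integer $\le y$. For $x\ge1$ and integers $a,q$ with $q\ge1$, $N_{c}(x;a,q)$ denotes the number of positive integers $n\le x$ such that $[n^{c}]\equiv a \pmod q$. *)

(* Defs.v *)
From mathcomp Require Import all_boot all_order all_algebra.
From mathcomp Require Import all_classical all_reals all_analysis.

Set Implicit Arguments.
Unset Strict Implicit.
Unset Printing Implicit Defensive.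

Import Order.TTheory GRing.Theory Num.Theory.

Local Open Scope ring_scope.

(* For 0 <= x, the indices 1 <= n < (Num.truncn x).+1 are exactly the positive
   integers n with n%:R <= x (see [truncn_ge_nat]). *)
Definition PS_count (R : realType) (c x : R) (a q : int) : nat :=
  (\sum_(1 <= n < (Num.truncn x).+1
         | (Num.floor (n%:R `^ c : R) == a %[mod q])%Z) 1)%N.

(* Main.v *)
Require Import Defs.
From mathcomp Require Import all_boot all_order all_algebra.
From mathcomp Require Import all_classical all_reals all_analysis.
From mathcomp Require Import ring lra zify.

Set Implicit Arguments.
Unset Strict Implicit.
Unset Printing Implicit Defensive.

Import Order.TTheory GRing.Theory Num.Theory.
Import numFieldNormedType.Exports.

Local Open Scope ring_scope.

(** Since [n ^ c] reduces mod [q] to [a] exactly when the fractional part of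
    [(n ^ c - a) / q] is below [1 / q], the count minus [x / q] is a difference
    of two sums of the sawtooth [{y} - 1/2] over [y = n ^ c / q + const].  On a
    dyadic block put [lam = x ^ (c - k) / q], the size of the [k]-th derivative;
    the target is [x * lam ^ (1 / (2 ^ k - 1))].  Smoothing the sawtooth at
    scale [s = lam ^ (1 / (2 ^ k - 1))] reduces it to the exponential sums with
    phases [j * n ^ c / q], which van der Corput's [k]-th derivative test bounds
    by [x * (j * lam) ^ (1 / (2 ^ k - 2))].

    The usual second term of that test is too large here.  It disappears
    because [c] is not an integer: all differences of [n ^ c] have their
    expected size, so the first difference in the base case [k = 2] is either
    small (Kuzmin-Landau) or runs through many unit intervals.  This works as
    soon as [lam] exceeds [x ^ (- 2)] by a power of [x]; when
    [lam < x ^ (- 2 + 2 ^ (1 - k))] the bound for [k - 1] is already stronger.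
    For [k = 1] the count is at most [x ^ c / q + 1], because [n ^ c] increases
    by at least 1 at each step. *)

(** * The Kuzmin-Landau inequality *)

(** The mean value theorem gives $\sin(x/2)=(x/2)\cos z$ with $z<x/2$, so $\sin x\ge
    x\cos^2(x/2)=x(1+\cos x)/2$. *)
Lemma sin_ge_half (R : realType) (x : R) : 0 <= x <= pi / 2 -> x / 2 <= sin x.
Proof.
move=> /andP[x0 x1].
have p0 := pi_gt0 R.
have [|xn0] := eqVneq x 0; first by move=> ->; rewrite sin0 mul0r.
have xp : 0 < x by rewrite lt0r xn0.
have x2 : 0 < x / 2 by lra.
have [|z zx] := @MVT R sin cos 0 (x / 2) x2 (fun y _ => is_derive_sin y).
  exact/continuous_subspaceT/continuous_sin.
rewrite sin0 !subr0 => Es.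
have cz : cos (x / 2) <= cos z.
  move: zx; rewrite in_itv/= => /andP[z0 zx].
  by apply: ltW; rewrite ltr_cos ?in_itv/=; apply/andP || done; split; lra.
have c0 : 0 <= cos x by apply: cos_ge0_pihalf; apply/andP; split; lra.
have c1 : 0 <= cos (x / 2) by apply: cos_ge0_pihalf; apply/andP; split; lra.
have Ex : x = (x / 2) *+ 2 by rewrite mulr2n; lra.
have E2 : cos x = 2 * cos (x / 2) ^+ 2 - 1.
  by rewrite {1}Ex cos_mulr2n mulr2n; ring.
have E1 : sin x = 2 * (cos (x / 2) * sin (x / 2)).
  by rewrite {1}Ex sin_mulr2n mulr2n; ring.
rewrite E1 Es.
have : cos (x / 2) ^+ 2 <= cos (x / 2) * cos z by rewrite expr2 ler_wpM2l.
nra.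
Qed.

Lemma sin_pi_ge (R : realType) (t v : R) :
  0 <= t -> t <= v <= 1 - t -> t <= sin (pi * v).
Proof.
move=> t0 /andP[tv vt]; have p2 := pi_ge2 R.
have H (w : R) : t <= w -> w <= 1 / 2 -> t <= sin (pi * w).
  move=> tw w2; apply: (@le_trans _ _ (pi * w / 2)).
    have : 2 * w <= pi * w by apply: ler_wpM2r => //; lra.
    lra.
  apply: sin_ge_half; apply/andP; split; first by apply: mulr_ge0; lra.
  by rewrite ler_pM2l; lra.
have [vl|vg] := leP v (1 / 2); first exact: H.
have -> : sin (pi * v) = sin (pi * (1 - v)).
  have -> : pi * (1 - v) = - (pi * v) + pi by ring.
  by rewrite sinDpi sinN opprK.
by apply: H; lra.
Qed.

Lemma dist_sin (R : realType) (x y : R) : `|sin x - sin y| <= `|x - y|.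
Proof.
wlog xy : x y / y <= x.
  move=> H; have [|/ltW] := leP y x; first exact: H.
  by move=> xy; rewrite distrC (distrC x); apply: H.
have [|c _ ->] := @MVT_segment R sin cos y x xy (fun y _ => is_derive_sin y).
  exact/continuous_subspaceT/continuous_sin.
by rewrite normrM ler_piMl ?normr_ge0// cos_max.
Qed.

Lemma dist_cos (R : realType) (x y : R) : `|cos x - cos y| <= `|x - y|.
Proof.
rewrite -!sinDpihalf; apply: le_trans (dist_sin _ _) _.
by rewrite opprD addrACA subrr addr0.
Qed.

Lemma cosD_int (R : realType) (y : R) (z : int) :
  cos (2 * pi * (y + z%:~R)) = cos (2 * pi * y).
Proof.
have Hn (w : R) (n : nat) : cos (2 * pi * (w + n%:R)) = cos (2 * pi * w).
  rewrite -(periodicn (@cosD2pi R) n (2 * pi * w)); congr cos.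
  by rewrite -(mulr_natr (pi *+ 2)) -(mulr_natr pi); ring.
case: z => n; first exact: Hn.
by rewrite NegzE mulrNz -(Hn _ n.+1) subrK.
Qed.

Definition fdiff (R : realType) (u : nat -> R) : nat -> R :=
  fun n => u n.+1 - u n.

(** Only the real part of the exponential sum is kept; constant shifts of the phase recover the
    sines. *)
Definition cosum (R : realType) (u : nat -> R) (L : nat) : R :=
  \sum_(i < L) cos (2 * pi * u i).

Lemma eq_cosum (R : realType) (u v : nat -> R) (L : nat) :
  (forall n, (n < L)%N -> cos (2 * pi * u n) = cos (2 * pi * v n)) ->
  cosum u L = cosum v L.
Proof. by move=> uv; apply: eq_bigr => i _; apply: uv. Qed.

Lemma norm_cosum_le (R : realType) (u : nat -> R) (L : nat) :
  `|cosum u L| <= L%:R.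
Proof.
apply: le_trans (ler_norm_sum _ _ _) _.
apply: le_trans (ler_sum _ (fun i _ => cos_max _)) _.
by rewrite sumr_const card_ord.
Qed.

Lemma cosum_cat (R : realType) (u : nat -> R) (l m : nat) :
  cosum u (l + m) = cosum u l + cosum (fun n => u (l + n)%N) m.
Proof. by rewrite /cosum big_split_ord. Qed.

Lemma cosumN (R : realType) (u : nat -> R) (L : nat) :
  cosum (fun n => - u n) L = cosum u L.
Proof. by apply: eq_cosum => n _; rewrite mulrN cosN. Qed.

(** Removing the linear phase $jn$ lowers every first difference by $j$, which moves any unit
    interval of first differences to the one starting at 0. *)
Lemma cosumD_int (R : realType) (u : nat -> R) (j : int) (L : nat) :
  cosum (fun n => u n - (j * n%:Z)%:~R) L = cosum u L.
Proof. by apply: eq_cosum => n _; rewrite -mulrNz cosD_int. Qed.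

(** Summation by parts: the two boundary terms cost $2G$, and the total variation of the monotone
    [c] telescopes to at most $2G$. *)
Lemma abel_bound (R : realType) (c s : nat -> R) (G : R) (L : nat) :
  (forall n, (n < L)%N -> `|c n| <= G) ->
  (forall n, (n.+1 < L)%N -> c n.+1 <= c n) ->
  (forall n, `|s n| <= 1) -> 0 <= G ->
  `|\sum_(i < L) c i * (s i.+1 - s i)| <= 4 * G.
Proof.
move=> cG cm s1 G0; case: L cG cm => [|L] cG cm.
  by rewrite big_ord0 normr0 mulr_ge0.
have -> : \sum_(i < L.+1) c i * (s i.+1 - s i) =
    c L * s L.+1 - c 0%N * s 0%N + \sum_(i < L) (c i - c i.+1) * s i.+1.
  elim: L {cG cm} => [|L IH]; first by rewrite big_ord1 big_ord0 /=; ring.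
  by rewrite big_ord_recr/= IH [in RHS]big_ord_recr/=; ring.
have H1 : `|\sum_(i < L) (c i - c i.+1) * s i.+1| <= c 0%N - c L.
  have -> : c 0%N - c L = \sum_(i < L) (c i - c i.+1).
    rewrite -(big_mkord predT (fun i => c i - c i.+1)).
    by rewrite -opprB -telescope_sumr// -sumrN; apply: eq_bigr => i _; ring.
  apply: le_trans (ler_norm_sum _ _ _) _; apply: ler_sum => i _.
  have ci : c i.+1 <= c i by apply: cm; rewrite ltnS.
  by rewrite normrM ger0_norm ?subr_ge0// ler_piMr// subr_ge0.
have c0 := cG 0%N isT; have cL := cG L (ltnSn L).
have H2 : `|c L * s L.+1| <= G.
  by rewrite normrM; apply: le_trans cL; rewrite ler_piMr.
have H3 : `|c 0%N * s 0%N| <= G.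
  by rewrite normrM; apply: le_trans c0; rewrite ler_piMr.
move: H1 H2 H3 c0 cL; rewrite !ler_norml => /andP[? ?] /andP[? ?] /andP[? ?].
by move=> /andP[? ?] /andP[? ?]; apply/andP; split; lra.
Qed.

(** Put $w=\pi(u_{n+1}-u_n)$. Each cosine equals half the drop of $\cos 2\pi u_n$ plus $\cot w$
    times half the increment of $\sin 2\pi u_n$. The first part telescopes. In the second, $\cot w$
    is nonincreasing in $n$ and at most $1/t$ in absolute value, so [abel_bound] applies. *)
Lemma kuzmin_landau0 (R : realType) (u : nat -> R) (t : R) (L : nat) :
  0 < t -> (forall n, (n < L)%N -> t <= fdiff u n <= 1 - t) ->
  (forall n, (n.+1 < L)%N -> fdiff u n <= fdiff u n.+1) ->
  `|cosum u L| <= 3 / t.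
Proof.
move=> t0 ut um.
case: L ut um => [|L] ut um.
  by rewrite /cosum big_ord0 normr0 divr_ge0// ltW.
have t2 : t <= 1 / 2 by have /andP[] := ut 0%N isT; lra.
pose w n : R := pi * fdiff u n.
pose c n : R := cos (w n) / sin (w n).
pose s n : R := sin (2 * pi * u n).
have ws n : (n < L.+1)%N -> t <= sin (w n).
  by move=> nL; apply: sin_pi_ge; [exact: ltW|exact: ut].
have E : cosum u L.+1 =
    - (cos (2 * pi * u L.+1) - cos (2 * pi * u 0%N)) / 2
    + (\sum_(i < L.+1) c i * (s i.+1 - s i)) / 2.
  have -> : cos (2 * pi * u L.+1) - cos (2 * pi * u 0%N) =
      \sum_(i < L.+1) (cos (2 * pi * u i.+1) - cos (2 * pi * u i)).
    rewrite -(big_mkord predT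
      (fun i => cos (2 * pi * u i.+1) - cos (2 * pi * u i))).
    by rewrite telescope_sumr.
  rewrite -mulrDl -sumrN -big_split/= mulr_suml; apply: eq_bigr => i _.
  have sw : sin (w i) != 0 by rewrite gt_eqF// (lt_le_trans t0)// ws.
  rewrite /s /c.
  have -> : 2 * pi * u i.+1 = 2 * pi * u i + (w i + w i).
    by rewrite /w /fdiff; ring.
  move: (2 * pi * u i) => y.
  rewrite (cosD y) (sinD y) (cosD (w i)) (sinD (w i)).
  have /eqP := cos2Dsin2 (w i); rewrite -subr_eq0 => /eqP E1.
  apply: (mulIf sw); apply/eqP; rewrite -subr_eq0; apply/eqP.
  (* The two sides differ by a multiple of $\cos^2 w+\sin^2 w-1$. *)
  transitivity ((cos (w i) ^+ 2 + sin (w i) ^+ 2 - 1) *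
    (- cos y * sin (w i) / 2 - sin y * cos (w i) / 2)); last first.
    by rewrite E1; ring.
  by field.
have Ht : 1 <= t^-1 by rewrite -[1]invr1 lef_pV2 ?posrE//; lra.
have H : `|\sum_(i < L.+1) c i * (s i.+1 - s i)| <= 4 * t^-1.
  apply: abel_bound.
  - move=> n nL; rewrite /c normrM normfV.
    have sp : 0 < sin (w n) by apply: lt_le_trans t0 _; apply: ws.
    rewrite (gtr0_norm sp); apply: le_trans (_ : (sin (w n))^-1 <= _).
      by rewrite ler_piMl ?cos_max// invr_ge0 ltW.
    by rewrite lef_pV2 ?posrE//; apply: ws.
  - move=> n nL.
    have s1 : 0 < sin (w n) by apply: lt_le_trans t0 _; apply: ws; apply: ltnW.
    have s2 : 0 < sin (w n.+1) by apply: lt_le_trans t0 _; apply: ws.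
    (* Comparing the cotangents amounts to $\sin(w_{n+1}-w_n)\ge0$. *)
    rewrite /c ler_pdivrMr// mulrAC ler_pdivlMr// -subr_ge0.
    have -> : cos (w n) * sin (w n.+1) - cos (w n.+1) * sin (w n) =
      sin (w n.+1 - w n) by rewrite sinB; ring.
    have p0 := pi_gt0 R.
    have := um n nL; have := ut _ nL; have := ut n (ltnW nL).
    move=> /andP[h1 h2] /andP[h3 h4] h5.
    rewrite -mulrBr; apply: sin_ge0_pi; apply/andP; split.
      by apply: mulr_ge0; lra.
    by rewrite ler_piMr; lra.
  - by move=> n; exact: sin_max.
  - by rewrite invr_ge0 ltW.
rewrite E; move: H; move: (\sum_(_ < _) _) => A.
have := cos_max (2 * pi * u L.+1); have := cos_max (2 * pi * u 0%N).
rewrite !ler_norml => /andP[? ?] /andP[? ?] /andP[? ?].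
by apply/andP; split; lra.
Qed.

Lemma kuzmin_landau (R : realType) (u : nat -> R) (j : int) (t : R) (L : nat) :
  0 < t -> (forall n, (n < L)%N -> j%:~R + t <= fdiff u n <= j%:~R + 1 - t) ->
  (forall n, (n.+1 < L)%N -> fdiff u n <= fdiff u n.+1) ->
  `|cosum u L| <= 3 / t.
Proof.
move=> t0 ut um; rewrite -(cosumD_int u j).
have fE n : fdiff (fun n => u n - (j * n%:Z)%:~R) n = fdiff u n - j%:~R.
  by rewrite /fdiff !intrM -!pmulrn -natr1; ring.
apply: kuzmin_landau0 => // n nL; rewrite !fE.
  by have /andP[? ?] := ut n nL; apply/andP; split; lra.
by rewrite lerD2r; apply: um.
Qed.

(** * The second difference test *)

Ltac split_lra :=
  intros; repeat first [apply/andP; split | split]; lra.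

Lemma monotone_split (R : realType) (v : nat -> R) (t : R) (L : nat) :
  (forall n, (n.+1 < L)%N -> v n <= v n.+1) ->
  exists l, [/\ (l <= L)%N, forall n, (n < l)%N -> v n < t &
    forall n, (l <= n < L)%N -> t <= v n].
Proof.
elim: L => [|L IH] vm; first by exists 0%N; split=> // n; rewrite andbF.
have [|l [lL h1 h2]] := IH; first by move=> n nL; apply: vm; apply: ltnW.
have [tv|vt] := leP t (v L).
  exists l; split=> //; first exact: ltnW.
  move=> n /andP[ln]; rewrite ltnS leq_eqVlt => /orP[/eqP->//|nL].
  by apply: h2; rewrite ln.
exists L.+1; split=> //; last by move=> n /andP[? ?]; lia.
move=> n; rewrite ltnS leq_eqVlt => /orP[/eqP->//|nL].
have [nl|ln] := ltnP n l; first exact: h1.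
have tn : t <= v n by apply: h2; rewrite ln.
exfalso; move: vt; apply/negP; rewrite -leNgt; apply: le_trans tn _.
have : (n <= L)%N by apply: ltnW.
move: (leqnn L); elim: {-2}L => [|m IHm] mL nm.
  by move: nm; rewrite leqn0 => /eqP ->.
move: nm; rewrite leq_eqVlt => /orP[/eqP->//|nm].
apply: le_trans (IHm (ltnW mL) nm) _; apply: vm; lia.
Qed.

Lemma sparse_count (R : realType) (v : nat -> R) (lam w t : R) (L : nat) :
  0 < lam -> 0 <= w -> (forall n, (n.+1 < L)%N -> v n + lam <= v n.+1) ->
  (forall n, (n < L)%N -> t <= v n <= t + w) -> L%:R <= w / lam + 1.
Proof.
move=> l0 w0; case: L => [|L] vl vt.
  by rewrite addr_ge0// divr_ge0// ltW.
have H : v 0%N + L%:R * lam <= v L.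
  elim: {-2}L (leqnn L) => [|m IH] mL; first by rewrite mul0r addr0.
  have := vl m mL; have := IH (ltnW mL); rewrite -natr1; lra.
rewrite -natr1 lerD2r ler_pdivlMr//.
have := vt 0%N isT; have := vt L (ltnSn L); lra.
Qed.

(** The first difference is within [t] of $j$ or of $j+1$ for at most $t/\lambda+1$ indices each,
    which are counted trivially; on the indices between, Kuzmin-Landau applies. *)
Lemma cosum_unit_range (R : realType) (u : nat -> R) (j : int) (lam t : R)
    (L : nat) :
  0 < lam -> 0 < t -> t <= 1 / 2 ->
  (forall n, (n.+1 < L)%N -> fdiff u n + lam <= fdiff u n.+1) ->
  (forall n, (n < L)%N -> j%:~R <= fdiff u n < j%:~R + 1) ->
  `|cosum u L| <= 2 * (t / lam + 1) + 3 / t.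
Proof.
move=> l0 t0 t2 ul uj.
have um n : (n.+1 < L)%N -> fdiff u n <= fdiff u n.+1.
  by move=> /ul; lra.
have [l [lL h1 h2]] := monotone_split (j%:~R + t) um.
rewrite -(subnKC lL) cosum_cat.
have um2 n : (n.+1 < L - l)%N ->
    fdiff (fun n => u (l + n)%N) n <= fdiff (fun n => u (l + n)%N) n.+1.
  by move=> nL; have := um (l + n)%N; rewrite /fdiff !addnS; apply; lia.
have [l' [lL' h1' h2']] := monotone_split (j%:~R + 1 - t) um2.
rewrite -(subnKC lL') cosum_cat.
have A1 : `|cosum u l| <= t / lam + 1.
  apply: le_trans (norm_cosum_le _ _) _.
  apply: (@sparse_count _ (fdiff u) _ _ j%:~R) => //; first exact: ltW.
    by move=> n nl; apply: ul; lia.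
  move=> n nl; have := h1 n nl; have := uj n; rewrite (leq_trans nl lL).
  by move=> /(_ isT); split_lra.
have A2 : `|cosum (fun n => u (l + n)%N) l'| <= 3 / t.
  apply: (@kuzmin_landau _ _ j) => // n nl.
    have := h1' n nl; have := h2 (l + n)%N; rewrite /fdiff addnS /=.
    have -> : (l <= l + n < L)%N by lia. move=> /(_ isT); split_lra.
  by apply: um2; lia.
have A3 : `|cosum (fun n => u (l + (l' + n))%N) (L - l - l')| <= t / lam + 1.
  apply: le_trans (norm_cosum_le _ _) _.
  apply: (@sparse_count _ (fun n => fdiff u (l + (l' + n))) _ _
    (j%:~R + 1 - t)) => //; first exact: ltW.
    by move=> n nl; rewrite !addnS; apply: ul; lia.
  move=> n nl; have := h2' (l' + n)%N; rewrite /fdiff !addnS /=.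
  have -> : (l' <= l' + n < L - l)%N by lia.
  move=> /(_ isT); have := uj (l + (l' + n))%N; rewrite /fdiff.
  have -> : (l + (l' + n) < L)%N by lia.
  by move=> /(_ isT); split_lra.
move: A1 A2 A3; rewrite !ler_norml; split_lra.
Qed.

Lemma cosum_range (R : realType) (J : nat) (u : nat -> R) (j : int)
    (lam t : R) (L : nat) :
  0 < lam -> 0 < t -> t <= 1 / 2 ->
  (forall n, (n.+1 < L)%N -> fdiff u n + lam <= fdiff u n.+1) ->
  (forall n, (n < L)%N -> j%:~R <= fdiff u n < j%:~R + J%:R) ->
  `|cosum u L| <= J%:R * (2 * (t / lam + 1) + 3 / t).
Proof.
elim: J u j L => [|J IH] u j L l0 t0 t2 ul uj.
  case: L ul uj => [|L] ul uj; first by rewrite /cosum big_ord0 normr0 mul0r.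
  by have := uj 0%N isT; split_lra.
have um n : (n.+1 < L)%N -> fdiff u n <= fdiff u n.+1.
  by move=> /ul; lra.
have [l [lL h1 h2]] := monotone_split (j%:~R + 1) um.
rewrite -(subnKC lL) cosum_cat.
rewrite -natr1 mulrDl mul1r [leRHS]addrC; apply: le_trans (ler_normD _ _) _.
apply: lerD.
  apply: (@cosum_unit_range _ _ j) => // n nl; first by apply: ul; lia.
  have := h1 n nl; have := uj n; rewrite (leq_trans nl lL).
  by move=> /(_ isT); split_lra.
apply: (IH _ (j + 1)) => // n nl.
  by have := ul (l + n)%N; rewrite /fdiff !addnS; apply; lia.
have := h2 (l + n)%N; have := uj (l + n)%N; rewrite /fdiff !addnS /=.
have -> : (l <= l + n < L)%N by lia.
have -> : (l + n < L)%N by lia.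
by move=> /(_ isT) + /(_ isT); rewrite intrD -natr1; split_lra.
Qed.

(** The choice $t=\sqrt\lambda/2$ balances $t/\lambda$ against $1/t$ in each unit interval met by
    the first difference. *)
Lemma cosum_second_diff (R : realType) (u : nat -> R) (A D lam : R) (L : nat) :
  0 < lam -> lam <= 1 -> 0 <= D ->
  (forall n, (n.+1 < L)%N -> fdiff u n + lam <= fdiff u n.+1) ->
  (forall n, (n < L)%N -> A <= fdiff u n <= A + D) ->
  `|cosum u L| <= (D + 3) * (9 / Num.sqrt lam).
Proof.
move=> l0 l1 D0 ul uA.
pose s := Num.sqrt lam.
have s0 : 0 < s by rewrite sqrtr_gt0.
have ss : s * s = lam by rewrite -expr2 sqr_sqrtr// ltW.
have s1 : s <= 1 by rewrite -sqrtr1 ler_wsqrtr.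
have [fl fl1] : (Num.floor A)%:~R <= A /\ A < (Num.floor A)%:~R + 1.
  by split; [exact: ge_floor|rewrite -intrD1; exact: lt_succ_floor].
(* Unit intervals are counted from the floor of [A], hence $D+1$ rather than $D$. *)
have [J [J1 J2]] : exists J : nat, D + 1 < J%:R /\ J%:R <= D + 3 :> R.
  have D1 : 0 <= D + 1 by lra.
  have /andP[h1 h2] := truncn_itv D1; exists (Num.truncn (D + 1)).+1.
  by split=> //; rewrite -natr1; lra.
have H := @cosum_range _ J u (Num.floor A) lam (s / 2) L l0.
apply: le_trans (H _ _ ul _) _; [lra|lra| |].
  by move=> n /uA; split_lra.
rewrite -/s; have i0 : 1 <= s^-1 by rewrite -[1]invr1 lef_pV2 ?posrE.
apply: ler_pM => //; first by apply: addr_ge0; rewrite ?mulr_ge0 ?addr_ge0 ?divr_ge0//; lra.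
rewrite -ss; have -> : 2 * (s / 2 / (s * s) + 1) + 3 / (s / 2) = 7 / s + 2.
  by field; rewrite gt_eqF.
lra.
Qed.

(* The two-sided bound on the [(k - 1)]-st difference is what removes the second
   term of the classical test.  The range [n <= 2 * k * x] shrinks by [2 * x] at
   each differencing with shifts at most [x]. *)
Definition diff_class (R : realType) (k : nat) (b B x lam : R)
    (u : nat -> R) : Prop :=
  exists s s' : R, [/\ s = 1 \/ s = -1, s' = 1 \/ s' = -1 &
    forall n : nat, n%:R <= 2 * k%:R * x ->
      b * lam <= s * iter k (@fdiff R) u n <= B * lam /\
      b * (x * lam) <= s' * iter k.-1 (@fdiff R) u n <= B * (x * lam)].

(** Three regimes. For $b\lambda>1$ the trivial bound suffices. If $Bx\lambda\le1/2$, the first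
    difference stays on one side of 0 and close to it, and Kuzmin-Landau gives $1/(x\lambda)$.
    Otherwise it meets $O(x\lambda)$ unit intervals, each costing $O(\lambda^{-1/2})$. *)
Lemma van_der_corput2 (R : realType) (b B : R) : 0 < b -> b <= B ->
  exists C : R, 0 < C /\ forall (x lam : R) (u : nat -> R) (L : nat),
    1 <= x -> 0 < lam -> diff_class 2 b B x lam u -> L%:R <= x ->
    `|cosum u L| <= C * (x * Num.sqrt lam + (x * lam)^-1).
Proof.
move=> b0 bB.
have rb0 : 0 < Num.sqrt b by rewrite sqrtr_gt0.
have C0 : 0 < 3 / b + (1 + 63 * B) / Num.sqrt b.
  by apply: addr_gt0; apply: divr_gt0; lra.
exists (3 / b + (1 + 63 * B) / Num.sqrt b); split=> // x lam u L x1 l0 uP Lx.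
(* Negating [u] preserves the cosine sum, so the second difference may be taken positive. *)
wlog us : u uP / exists s', [/\ s' = 1 \/ s' = -1 & forall n, (n <= L)%N ->
      b * lam <= fdiff (fdiff u) n <= B * lam /\
      b * (x * lam) <= s' * fdiff u n <= B * (x * lam)].
  move=> H; have [s [s' [hs hs' us]]] := uP.
  have nx (n : nat) : (n <= L)%N -> n%:R <= 2 * 2 * x :> R.
    by move=> nL; apply: le_trans (_ : L%:R <= _); rewrite ?ler_nat//; lra.
  case: hs us => -> us.
    apply: H => //; exists s'; split=> // n nL; have [] := us n (nx n nL).
    by rewrite mul1r.
  rewrite -cosumN; apply: H.
    exists 1, (- s'); split; [by left|by case: hs' => ->; rewrite ?opprK; [right|left]|].
    move=> n /us/=; rewrite /fdiff; split_lra.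
  exists (- s'); split; first by case: hs' => ->; rewrite ?opprK; [right|left].
  by move=> n nL; have [] := us n (nx n nL); rewrite /= /fdiff; split_lra.
have [s' [hs' {}us]] := us.
have xl0 : 0 < x * lam by apply: mulr_gt0 => //; lra.
have sl0 : 0 < Num.sqrt lam by rewrite sqrtr_gt0.
have xsl0 : 0 < x * Num.sqrt lam by apply: mulr_gt0 => //; lra.
have xli0 : 0 < (x * lam)^-1 by rewrite invr_gt0.
have B0 : 0 < B by lra.
have d1 : 0 < 3 / b by apply: divr_gt0; lra.
have d2 : 0 < 1 / Num.sqrt b by apply: divr_gt0; lra.
have d3 : 0 < 63 * B / Num.sqrt b by apply: divr_gt0; lra.
have ES : Num.sqrt (b * lam) = Num.sqrt b * Num.sqrt lam by rewrite sqrtrM// ltW.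
have bl0 : 0 < b * lam by exact: mulr_gt0.
have [bl1|bl1] := ltP 1 (b * lam).
  apply: le_trans (norm_cosum_le _ _) _; apply: le_trans Lx _.
  have e1 : 1 <= Num.sqrt b * Num.sqrt lam.
    by rewrite -ES -sqrtr1 ler_wsqrtr// ltW.
  have : x <= x * (Num.sqrt b * Num.sqrt lam) by rewrite ler_peMr//; lra.
  have f1 : b <= 63 * B by lra.
  have f2 : Num.sqrt b * (x * Num.sqrt lam) <= 63 * B / Num.sqrt b * (x * Num.sqrt lam).
    rewrite ler_pM2r// ler_pdivlMr// -expr2 sqr_sqrtr//; lra.
  nra.
have ui n : (n.+1 < L)%N -> fdiff u n + b * lam <= fdiff u n.+1.
  move=> nL; have [|/andP[+ _] _] := us n; first exact/ltnW/ltnW.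
  by rewrite {1}/fdiff; lra.
have [H|H] := leP (B * (x * lam)) (1 / 2).
  apply: (@le_trans _ _ (3 / (b * (x * lam)))).
    have t0 : 0 < b * (x * lam) by exact: mulr_gt0.
    have tt : b * (x * lam) <= B * (x * lam) by rewrite ler_pM2r.
    have um n : (n.+1 < L)%N -> fdiff u n <= fdiff u n.+1 by move=> /ui; lra.
    case: hs' us => -> us.
      by apply: kuzmin_landau0 => // n nL; have [|] := us n; [exact: ltnW|split_lra].
    (* A negative first difference lies between $-1/2$ and $-bx\lambda$, hence in the unit interval
       starting at $-1$. *)
    apply: (@kuzmin_landau _ _ (-1)) => // n nL.
    by rewrite mulrN1z; have [|] := us n; [exact: ltnW|split_lra].
  rewrite invfM mulrA; nra.
have [A uA] : exists A, forall n, (n < L)%N -> A <= fdiff u n <= A + B * (x * lam).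
  have t0 : 0 < b * (x * lam) by exact: mulr_gt0.
  case: hs' us => -> us.
    by exists 0 => n nL; have [|] := us n; [exact: ltnW|split_lra].
  by exists (- (B * (x * lam))) => n nL; have [|] := us n; [exact: ltnW|split_lra].
have D0 : 0 <= B * (x * lam) by lra.
apply: le_trans (cosum_second_diff bl0 bl1 D0 ui uA) _.
(* From $Bx\lambda>1/2$ follows $Bx\lambda+3\le7Bx\lambda$. *)
rewrite ES; apply: (@le_trans _ _ ((7 * (B * (x * lam))) * (9 / (Num.sqrt b * Num.sqrt lam)))).
  by rewrite ler_pM2r; [lra|apply: divr_gt0 => //; exact: mulr_gt0].
have E1 : 7 * (B * (x * lam)) * (9 / (Num.sqrt b * Num.sqrt lam)) =
    63 * B / Num.sqrt b * (x * Num.sqrt lam).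
  have : Num.sqrt lam * Num.sqrt lam = lam by rewrite -expr2 sqr_sqrtr// ltW.
  move: sl0 rb0; set p := Num.sqrt lam; set r := Num.sqrt b => p0 r0 <-.
  by field; rewrite !gt_eqF.
rewrite E1; nra.
Qed.

(** * Van der Corput differencing *)

(** Cauchy-Schwarz, from nonnegativity of the sum of squared deviations from the mean. *)
Lemma sqr_sum_le (R : realType) (c : nat -> R) (L : nat) :
  (\sum_(i < L) c i) ^+ 2 <= L%:R * \sum_(i < L) c i ^+ 2.
Proof.
case: L => [|L]; first by rewrite !big_ord0 expr0n mul0r.
set W := \sum_(i < L.+1) c i; set Q := \sum_(i < L.+1) _.
have L0 : (0 : R) < L.+1%:R by rewrite ltr0n.
have : 0 <= \sum_(i < L.+1) (c i - W / L.+1%:R) ^+ 2.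
  by apply: sumr_ge0 => i _; exact: sqr_ge0.
have -> : \sum_(i < L.+1) (c i - W / L.+1%:R) ^+ 2 = Q - W ^+ 2 / L.+1%:R.
  have -> : \sum_(i < L.+1) (c i - W / L.+1%:R) ^+ 2 =
      \sum_(i < L.+1) (c i ^+ 2 + (- 2 * (W / L.+1%:R)) * c i + (W / L.+1%:R) ^+ 2).
    by apply: eq_bigr => i _; ring.
  rewrite !big_split/= -mulr_sumr -/W -/Q sumr_const card_ord -mulr_natr.
  by field; rewrite gt_eqF.
by rewrite subr_ge0 ler_pdivrMr// mulrC.
Qed.

(** The two truncated subtractions add up to $|h-i|$, and each distance occurs at most twice. *)
Lemma sum_dist_le (R : realType) (F : nat -> R) (H h : nat) :
  (forall r, 0 <= F r) -> (h < H)%N ->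
  \sum_(i < H) F ((h - i) + (i - h))%N <= 2 * \sum_(i < H) F i.
Proof.
move=> F0 hH.
have mono m : (m <= H)%N -> \sum_(i < m) F i <= \sum_(i < H) F i.
  by move=> mH; rewrite -(subnKC mH) big_split_ord/= lerDl sumr_ge0.
have -> : \sum_(i < H) F ((h - i) + (i - h))%N =
    \sum_(i < h.+1) F i + \sum_(i < H - h.+1) F i.+1.
  rewrite -[in LHS](subnKC hH) big_split_ord/=; congr (_ + _).
    rewrite [RHS](reindex_inj rev_ord_inj)/=; apply: eq_bigr => i _.
    by congr F; have := ltn_ord i; lia.
  by apply: eq_bigr => i _; congr F; lia.
have h1 := mono _ hH.
have h2 : \sum_(i < H - h.+1) F i.+1 <= \sum_(i < H) F i.
  apply: le_trans (mono (H - h.+1).+1 _); last by lia.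
  by rewrite big_ord_recl/= lerDr.
lra.
Qed.

(** Shifting the sum by $h<H$ changes it by at most $2h$, so $H$ times the sum is close to the total
    [W] of its shifts. Cauchy-Schwarz applied to [W] leaves the correlations between pairs of
    shifts, which [F] bounds in terms of their distance. *)
Lemma van_der_corput_ineq (R : realType) (u : nat -> R) (F : nat -> R)
    (L H : nat) : (0 < H)%N -> (forall r, 0 <= F r) ->
  (forall h r, (h + r < H)%N ->
    `|cosum (fun n => u (n + (h + r))%N - u (n + h)%N) L| <= F r) ->
  cosum u L ^+ 2 <= 8 * H%:R ^+ 2 + 4 * (L%:R / H%:R * \sum_(r < H) F r).
Proof.
move=> H0 F0 HF.
pose A := cosum u L.
pose W : R := \sum_(h < H) cosum (fun n => u (n + h)%N) L.
have HR : (0 : R) < H%:R by rewrite ltr0n.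
have A1 : `|H%:R * A - W| <= 2 * H%:R ^+ 2.
  have -> : H%:R * A - W = \sum_(h < H) (A - cosum (fun n => u (n + h)%N) L).
    by rewrite sumrB sumr_const card_ord -[A *+ _]mulr_natl.
  have -> : 2 * H%:R ^+ 2 = \sum_(h < H) (2 * H%:R) :> R.
    by rewrite sumr_const card_ord -[RHS]mulr_natl; ring.
  apply: le_trans (ler_norm_sum _ _ _) _; apply: ler_sum => h _.
  have E : cosum u (L + h) = cosum u (h + L) by rewrite addnC.
  rewrite !cosum_cat in E.
  have E' : cosum (fun n => u (h + n)%N) L = cosum (fun n => u (n + h)%N) L.
    by apply: eq_cosum => n _; rewrite addnC.
  have hH : h%:R <= H%:R :> R by rewrite ler_nat ltnW.
  have := norm_cosum_le u h; have := norm_cosum_le (fun n => u (L + n)%N) h.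
  move: E; rewrite E' -/A !ler_norml; split_lra.
have A2 : W ^+ 2 <= L%:R * (H%:R * (2 * \sum_(r < H) F r)).
  pose c n : R := \sum_(h < H) cos (2 * pi * u (n + h)%N).
  pose s n : R := \sum_(h < H) sin (2 * pi * u (n + h)%N).
  have -> : W = \sum_(n < L) c n by rewrite /W /cosum exchange_big.
  apply: le_trans (sqr_sum_le _ _) _; apply: ler_wpM2l => //.
  (* The squares of the sine sums complete the modulus, so that products combine into cosines of
     phase differences. *)
  apply: (@le_trans _ _ (\sum_(n < L) (c n ^+ 2 + s n ^+ 2))).
    by apply: ler_sum => n _; rewrite lerDl sqr_ge0.
  have -> : \sum_(n < L) (c n ^+ 2 + s n ^+ 2) =
      \sum_(h < H) \sum_(h' < H) cosum (fun n => u (n + h)%N - u (n + h')%N) L.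
    rewrite /cosum; under [RHS]eq_bigr => h _ do rewrite exchange_big/=.
    rewrite [RHS]exchange_big/=; apply: eq_bigr => n _.
    rewrite !expr2 /c /s !mulr_suml -big_split/=; apply: eq_bigr => h _.
    rewrite !mulr_sumr -big_split/=; apply: eq_bigr => h' _.
    by rewrite mulrBr cosB.
  have -> : H%:R * (2 * \sum_(r < H) F r) = \sum_(h < H) (2 * \sum_(r < H) F r).
    by rewrite sumr_const card_ord -[RHS]mulr_natl.
  apply: ler_sum => h _; apply: le_trans (sum_dist_le F0 (ltn_ord h)).
  apply: ler_sum => h' _; apply: le_trans (ler_norm _) _.
  have [hh|hh] := leqP h' h.
    have -> : ((h - h') + (h' - h))%N = (h - h')%N by lia.
    apply: le_trans (HF h' (h - h')%N _); last by rewrite subnKC.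
    by rewrite subnKC.
  have -> : ((h - h') + (h' - h))%N = (h' - h)%N by lia.
  apply: le_trans (HF h (h' - h)%N _); last by rewrite subnKC// ltnW.
  rewrite subnKC ?(ltnW hh)// -cosumN.
  rewrite (@eq_cosum _ _ (fun n => u (n + h')%N - u (n + h)%N))// => n _.
  by rewrite opprB.
rewrite -/A -(ler_pM2l (exprn_gt0 2 HR)) -exprMn.
have -> : H%:R ^+ 2 * (8 * H%:R ^+ 2 + 4 * (L%:R / H%:R * \sum_(r < H) F r)) =
   2 * (2 * H%:R ^+ 2) ^+ 2 + 2 * (L%:R * (H%:R * (2 * \sum_(r < H) F r))).
  by field; rewrite gt_eqF.
have A3 : (H%:R * A - W) ^+ 2 <= (2 * H%:R ^+ 2) ^+ 2.
  by rewrite -real_normK ?num_real// lerXn2r ?nnegrE// mulr_ge0// sqr_ge0.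
(* Nonnegativity of $(HA-2W)^2$ means $(HA)^2\le2(HA-W)^2+2W^2$. *)
have := sqr_ge0 (H%:R * A - W - W).
move: A2 A3; move: (H%:R * A) => a; move: (2 * H%:R ^+ 2) => w.
by move: (_ * (_ * _)) => y; nra.
Qed.

Lemma iter_fdiff_sum (R : realType) (v w : nat -> R) (h r k : nat) :
  (forall n, v n = \sum_(i < r) w (n + h + i)%N) ->
  forall n, iter k (@fdiff R) v n = \sum_(i < r) iter k (@fdiff R) w (n + h + i)%N.
Proof.
move=> vw; elim: k => [//|k IH] n.
by rewrite /= {1}/fdiff !IH -sumrB; apply: eq_bigr => i _; rewrite /fdiff !addSn.
Qed.

(** The phase differenced with shift [r] is a sum of [r] consecutive first differences of [u], so
    its differences are sums of [r] differences of [u] of one order higher, all of the same sign and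
    size. *)
Lemma diff_class_shift (R : realType) (k : nat) (b B x lam : R) (u : nat -> R)
    (h r : nat) : (1 <= k)%N -> (h + r)%:R <= x ->
  diff_class k.+1 b B x lam u ->
  diff_class k b B x (r%:R * lam) (fun n => u (n + (h + r))%N - u (n + h)%N).
Proof.
move=> k1 hx [s [s' [hs hs' us]]]; exists s, s'; split=> // n nx.
have vE m : u (m + (h + r))%N - u (m + h)%N = \sum_(i < r) fdiff u (m + h + i)%N.
  rewrite /fdiff -(big_mkord predT (fun i => u (m + h + i).+1 - u (m + h + i)%N)).
  by under eq_bigr => i _ do rewrite -addnS; rewrite telescope_sumr// addn0 addnA.
have bnd (i : 'I_r) : (n + h + i)%:R <= 2 * k.+1%:R * x.
  have hi : (h + i)%:R <= x by apply: le_trans hx; rewrite ler_nat leq_add2l ltnW.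
  have : 0 <= (h + i)%:R :> R by [].
  by rewrite -addnA (natrD _ n) -[k.+1%:R]natr1; lra.
have sc (c y : R) : c * (r%:R * y) = \sum_(i < r) c * y.
  by rewrite sumr_const card_ord -[RHS]mulr_natl; ring.
case: k k1 us vE bnd nx => // k _ us vE bnd nx.
have -> : x * (r%:R * lam) = r%:R * (x * lam) by ring.
rewrite !(iter_fdiff_sum _ vE) -!iterSr !mulr_sumr !sc.
by split; apply/andP; split; apply: ler_sum => i _;
  have [/andP[h1 h2] /andP[h3 h4]] := us _ (bnd i).
Qed.

(** Induction reduces this to $M^a\le(M+1)^a(1-y/2)$ with $y=a/(M+1)$, which follows from
    $(1-1/(M+1))^a\le e^{-y}\le1/(1+y)\le1-y/2$. *)
Lemma sum_powR_le (R : realType) (a : R) (M : nat) : 0 < a -> a <= 1 ->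
  \sum_(i < M) i.+1%:R `^ (a - 1) <= 2 / a * M%:R `^ a.
Proof.
move=> a0 a1; elim: M => [|M IH].
  by rewrite big_ord0 mulr_ge0 ?powR_ge0// divr_ge0// ltW.
rewrite big_ord_recr/=; apply: le_trans (lerD IH (lexx _)) _.
have m0 : (0 : R) < M.+1%:R by rewrite ltr0n.
have -> : M.+1%:R `^ (a - 1) = M.+1%:R `^ a / M.+1%:R.
  by rewrite powRB ?powRr1// ?(ltW m0)//; apply/implyP; rewrite pnatr_eq0.
have ai0 : 0 < 2 / a by apply: divr_gt0.
pose y := a / M.+1%:R.
have y0 : 0 < y by apply: divr_gt0.
have y1 : y <= 1.
  by rewrite ler_pdivrMr// mul1r; apply: le_trans a1 _; rewrite ler1n.
suff H : M%:R `^ a <= M.+1%:R `^ a * (1 - y / 2).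
  have -> : M.+1%:R `^ a / M.+1%:R = 2 / a * (M.+1%:R `^ a * (y / 2)).
    by rewrite /y; field; rewrite !gt_eqF.
  by rewrite -mulrDr ler_pM2l//; lra.
case: M {IH} m0 @y y0 y1 => [|M] m0 y y0 y1.
  rewrite powR0 ?gt_eqF//; apply: mulr_ge0; first exact: powR_ge0.
  lra.
have -> : M.+1%:R = M.+2%:R * (1 - M.+2%:R^-1) :> R.
  by rewrite mulrBr mulr1 divff ?gt_eqF// -[M.+2%:R]natr1 addrK.
have i1 : 0 < 1 - M.+2%:R^-1 :> R.
  by rewrite subr_gt0 invf_lt1// ltr1n.
rewrite powRM ?(ltW m0) ?(ltW i1)// ler_pM2l ?powR_gt0//.
rewrite /powR gt_eqF//.
have l1 : ln (1 - M.+2%:R^-1) <= - M.+2%:R^-1 :> R.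
  rewrite -[leRHS]expRK ler_ln ?posrE ?expR_gt0//.
  by rewrite -[leLHS]/(1 + - M.+2%:R^-1); exact: expR_ge1Dx.
apply: (@le_trans _ _ (expR (- y))).
  by rewrite ler_expR /y -mulrN ler_pM2l.
rewrite expRN; apply: (@le_trans _ _ (1 + y)^-1).
  by rewrite lef_pV2 ?posrE ?expR_gt0//; [exact: expR_ge1Dx|lra].
rewrite -[leLHS]mul1r ler_pdivrMr; last lra.
nra.
Qed.

(** A small power of [M] replaces the logarithm; the differencing step leaves room for it. *)
Lemma sum_inv_le (R : realType) (a : R) (M : nat) : 0 < a -> a <= 1 ->
  \sum_(i < M) (i.+1%:R)^-1 <= 2 / a * M%:R `^ a.
Proof.
move=> a0 a1; apply: le_trans (sum_powR_le M a0 a1); apply: ler_sum => i _.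
by rewrite -powR_inv1// ler_powR ?ler1n//; lra.
Qed.

(** With $H\approx\lambda^{-e}$ shifts, the diagonal contributes $x^2/H$ and the other shifts
    $x^2(H\lambda)^a$; the relation $e(1+a)=a$ makes both of size $x^2\lambda^e$. The secondary
    terms $G/r$ sum to $O(Gx^\eta)$, which is at most of the size of the diagonal. *)
Lemma van_der_corput_step (R : realType) (x lam a e C G eta : R)
    (u : nat -> R) (L : nat) :
  1 <= x -> 0 < lam -> lam <= 1 -> lam^-1 <= x ^+ 2 ->
  0 < a -> a <= 1 / 2 -> e * (1 + a) = a -> 0 <= C -> 0 <= G ->
  0 < eta -> eta <= 1 -> G * x `^ eta <= x -> L%:R <= x ->
  (forall h r, (0 < r)%N -> (h + r)%:R <= x ->
    `|cosum (fun n => u (n + (h + r))%N - u (n + h)%N) L|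
      <= C * (x * (r%:R * lam) `^ a + G / r%:R)) ->
  `|cosum u L| <= (16 + 4 * C + 16 * (C / eta)) * (x * lam `^ (e / 2)).
Proof.
move=> x1 l0 l1 lx a0 a2 ea C0 G0 t0 t1 Gx Lx hu.
have x0 : 0 < x by lra.
have e0 : 0 < e.
  by rewrite -(pmulr_lgt0 (x := 1 + a)); [rewrite ea|lra].
have e3 : e * 3 <= 1.
  have a10 : 0 < 1 + a by lra.
  by rewrite -subr_ge0 -(pmulr_lge0 _ a10); lra.
pose y := lam `^ (- e).
have y0 : 0 < y by apply: powR_gt0.
have ly0 : 0 < lam `^ e by apply: powR_gt0.
have yl : y * lam `^ e = 1 by rewrite /y powRN mulVf// gt_eqF.
have li1 : 1 <= lam^-1 by rewrite -[1]invr1 lef_pV2 ?posrE.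
have yE t : lam `^ (- t) = lam^-1 `^ t.
  by rewrite -(powR_inv1 (ltW l0)) -powRrM mulN1r.
(* This uses $e\le1/3$, and yields both $y\le x$ and $y^2\le x^2\lambda^e$. *)
have y3 : y ^+ 3 <= x ^+ 2.
  apply: le_trans lx; rewrite -powR_mulrn ?(ltW y0)// /y yE -powRrM.
  by rewrite -[leRHS]powRr1 ?invr_ge0 ?(ltW l0)//; apply: ler_powR.
have y1 : 1 <= y by rewrite /y yE -(powRr0 lam^-1); apply: ler_powR => //; exact: ltW.
have yx : y <= x.
  have [//|xy] := leP y x; have : x ^+ 2 < y ^+ 2 by nra.
  have : y ^+ 2 <= y ^+ 3 by apply: ler_weXn2l.
  lra.
have /andP[H1 H2] := truncn_itv (ltW y0).
case: (Num.truncn y) H1 H2 => [|H'] H1 H2.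
  by lra.
set H := H'.+1 in H1 H2 *.
have HR1 : 1 <= H%:R :> R by rewrite ler1n.
have HR : 0 < H%:R :> R by lra.
have Hi : (H%:R)^-1 <= 2 * lam `^ e.
  have yH : y <= 2 * H%:R by move: H2; rewrite -natr1; lra.
  by rewrite -[leLHS]mul1r ler_pdivrMr// -[leLHS]yl mulrAC ler_pM2r.
(* The value at 0 is the trivial bound, for the diagonal. *)
pose F (r : nat) : R := if r is r'.+1 then C * (x * lam `^ e + G / r%:R) else x.
have xle0 : 0 < x * lam `^ e by exact: mulr_gt0.
have F0 r : 0 <= F r.
  case: r => [|r] /=; first lra.
  by apply: mulr_ge0 => //; apply: addr_ge0; [exact: ltW|exact: divr_ge0].
have HF h r : (h + r < H)%N ->
    `|cosum (fun n => u (n + (h + r))%N - u (n + h)%N) L| <= F r.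
  move=> hr; have hrx : (h + r)%:R <= x.
    by apply: le_trans yx; apply: le_trans H1; rewrite ler_nat ltnW.
  case: r hr hrx => [|r] hr hrx.
    by apply: le_trans Lx; exact: norm_cosum_le.
  apply: le_trans (hu h r.+1 isT hrx) _; apply: ler_wpM2l => //.
  rewrite lerD2r ler_pM2l//.
  (* Since $a(1-e)=e$. *)
  have -> : lam `^ e = (y * lam) `^ a.
    rewrite powRM ?(ltW y0) ?(ltW l0)// -powRrM -powRD; last first.
      by apply/implyP => _; rewrite gt_eqF.
    by congr (lam `^ _); lra.
  have ryl : r.+1%:R * lam <= y * lam.
    rewrite ler_pM2r//; apply: le_trans H1; rewrite ler_nat.
    exact: leq_trans (leq_addl h _) (ltnW hr).
  apply: ge0_ler_powR => //; rewrite ?nnegrE; first exact: ltW.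
    by rewrite mulr_ge0// ltW.
  by rewrite mulr_ge0// ltW.
have SF : \sum_(r < H) F r <= x + C * (H%:R * (x * lam `^ e)) + C * (2 / eta * x).
  rewrite big_ord_recl/= -addrA lerD2l.
  rewrite -mulr_sumr -mulrDr; apply: ler_wpM2l => //.
  rewrite big_split/=; apply: lerD.
    rewrite sumr_const card_ord -[leLHS]mulr_natl ler_pM2r//.
    by rewrite ler_nat.
  rewrite -mulr_sumr; apply: (@le_trans _ _ (G * (2 / eta * x `^ eta))).
    apply: ler_wpM2l => //; apply: le_trans (sum_inv_le H' t0 t1) _.
    apply: ler_wpM2l; first by apply: divr_ge0 => //; exact: ltW.
    apply: ge0_ler_powR => //; rewrite ?nnegrE//; [exact: ltW|exact: ltW|].
    by apply: le_trans yx; apply: le_trans H1; rewrite ler_nat.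
  by rewrite mulrCA; apply: ler_wpM2l => //; apply: divr_ge0 => //; exact: ltW.
have := @van_der_corput_ineq _ u F L H isT F0 HF.
have P1 : H%:R ^+ 2 <= x ^+ 2 * lam `^ e.
  apply: (@le_trans _ _ (y ^+ 2)).
    by rewrite lerXn2r ?nnegrE// ltW.
  have -> : y ^+ 2 = y ^+ 3 * lam `^ e by rewrite (exprSr y 2) -mulrA yl mulr1.
  by rewrite ler_pM2r.
have P2 : L%:R / H%:R * \sum_(r < H) F r <=
    x / H%:R * (x + C * (H%:R * (x * lam `^ e)) + C * (2 / eta * x)).
  apply: ler_pM => //; first by apply: sumr_ge0.
  by rewrite ler_pM2r// invr_gt0.
have P3 : x / H%:R * (x + C * (H%:R * (x * lam `^ e)) + C * (2 / eta * x)) =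
    C * (x ^+ 2 * lam `^ e) + (1 + 2 * (C / eta)) * x ^+ 2 * H%:R^-1.
  by field; rewrite !gt_eqF.
have Ce0 : 0 <= C / eta by apply: divr_ge0 => //; exact: ltW.
have P4 : (1 + 2 * (C / eta)) * x ^+ 2 * H%:R^-1 <=
    (1 + 2 * (C / eta)) * x ^+ 2 * (2 * lam `^ e).
  by apply: ler_wpM2l => //; apply: mulr_ge0; [lra|exact: sqr_ge0].
set K := 16 + 4 * C + 16 * (C / eta).
have K1 : 1 <= K by rewrite /K; lra.
move=> P5.
have P6 : cosum u L ^+ 2 <= K * (x ^+ 2 * lam `^ e).
  by rewrite /K; lra.
have l2 : 0 < lam `^ (e / 2) by apply: powR_gt0.
have EL : lam `^ e = lam `^ (e / 2) ^+ 2.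
  by rewrite -powR_mulrn ?(ltW l2)// -powRrM; congr (_ `^ _); lra.
rewrite -(@ler_pXn2r _ 2)// ?nnegrE//; last first.
  by apply: mulr_ge0; [lra|apply: mulr_ge0; exact: ltW].
rewrite real_normK ?num_real//; apply: le_trans P6 _.
rewrite EL -exprMn [leRHS]exprMn; apply: ler_wpM2r; first exact: sqr_ge0.
by rewrite expr2 ler_peMl//; lra.
Qed.

Lemma expn2B_gt0 (R : realType) (k : nat) : (2 <= k)%N -> 2 <= 2 ^+ k - 2 :> R.
Proof.
move=> k2; have : 2 ^+ 2 <= 2 ^+ k :> R by rewrite ler_eXn2l// ltr1n.
lra.
Qed.

(** Each induction step is one differencing: $a=1/(2^k-2)$ leads to $e/2=1/(2^{k+1}-2)$. In the base
    case the lower bound on [lam] gives $x^\eta/(x\lambda)\le x$, which absorbs the second term of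
    [van_der_corput2]. This lower bound passes to $r\lambda$ because $r\ge1$. *)
Lemma van_der_corput (R : realType) (k : nat) (b B eta : R) :
  (3 <= k)%N -> 0 < b -> b <= B -> 0 < eta -> eta <= 1 ->
  exists C : R, 0 < C /\ forall (x lam : R) (u : nat -> R) (L : nat),
    1 <= x -> x `^ (- 2 + eta) <= lam -> diff_class k b B x lam u -> L%:R <= x ->
    `|cosum u L| <= C * (x * lam `^ (2 ^+ k - 2)^-1).
Proof.
move=> k3 b0 bB t0 t1; move: k3; rewrite -(subnK (isT : (2 < 3)%N)).
case: k => [//|[//|]] k; rewrite !ltnS => k1.
case: k k1 => [//|k] _; elim: k => [|k [C [C0 IH]]].
  have [C [C0 HC]] := van_der_corput2 b0 bB.
  exists (16 + 4 * C + 16 * (C / eta)); split.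
    have : 0 < C / eta by apply: divr_gt0.
    lra.
  move=> x lam u L x1 lx uP Lx.
  have x0 : 0 < x by lra.
  have l0 : 0 < lam by apply: lt_le_trans lx; apply: powR_gt0.
  have K1 : 1 <= 16 + 4 * C + 16 * (C / eta).
    have : 0 < C / eta by apply: divr_gt0.
    lra.
  have [l1|l1] := ltP 1 lam.
    apply: le_trans (norm_cosum_le _ _) _; apply: le_trans Lx _.
    have : 1 <= lam `^ (2 ^+ 3 - 2)^-1.
      rewrite -[leLHS](powRr0 lam); apply: ler_powR; first exact: ltW.
      by rewrite invr_ge0; have := expn2B_gt0 R (isT : (2 <= 3)%N); lra.
    move: (_ `^ _) => q q1; have : x <= x * q by rewrite ler_peMr// ltW.
    nra.
  have -> : (2 ^+ 3 - 2)^-1 = 3^-1 / 2 :> R by rewrite !exprS expr0; field.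
  have lx2 : x `^ eta <= x ^+ 2 * lam.
    have -> : x `^ eta = x ^+ 2 * x `^ (- 2 + eta).
      rewrite -powR_mulrn ?(ltW x0)// -powRD; first by congr (_ `^ _); lra.
      by apply/implyP => _; rewrite gt_eqF.
    by rewrite ler_pM2l// exprn_gt0.
  apply: (@van_der_corput_step R x lam (1 / 2) _ C (x * lam)^-1 eta) => //; try lra.
  - rewrite -[leLHS]mul1r ler_pdivrMr//; apply: le_trans lx2.
    by rewrite -[leLHS](powRr0 x); apply: ler_powR => //; exact: ltW.
  - by rewrite invr_ge0 mulr_ge0// ltW.
  - rewrite mulrC ler_pdivrMr ?mulr_gt0//; apply: le_trans lx2 _.
    by rewrite mulrA -expr2.
  - move=> h r r0 hx.
    have -> : (x * lam)^-1 / r%:R = (x * (r%:R * lam))^-1.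
      by rewrite -invfM; congr (_^-1); ring.
    rewrite mul1r powR12_sqrt; last by rewrite mulr_ge0// ltW.
    apply: HC => //; first by rewrite mulr_gt0// ltr0n.
    exact: diff_class_shift.
exists (16 + 4 * C + 16 * (C / eta)); split.
  have : 0 < C / eta by apply: divr_gt0.
  lra.
move=> x lam u L x1 lx uP Lx.
have x0 : 0 < x by lra.
have l0 : 0 < lam by apply: lt_le_trans lx; apply: powR_gt0.
have K1 : 1 <= 16 + 4 * C + 16 * (C / eta).
  have : 0 < C / eta by apply: divr_gt0.
  lra.
have Ek := expn2B_gt0 R (isT : (2 <= k.+3)%N).
have E2 : 2 ^+ k.+4 = 2 * 2 ^+ k.+3 :> R by rewrite exprS.
have [l1|l1] := ltP 1 lam.
  apply: le_trans (norm_cosum_le _ _) _; apply: le_trans Lx _.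
  have : 1 <= lam `^ (2 ^+ k.+4 - 2)^-1.
    rewrite -[leLHS](powRr0 lam); apply: ler_powR; first exact: ltW.
    by rewrite invr_ge0; lra.
  move: (_ `^ _) => q q1; have : x <= x * q by rewrite ler_peMr// ltW.
  nra.
rewrite E2; set E := (2 ^+ k.+3 : R) in E2 Ek *.
have -> : (2 * E - 2)^-1 = (E - 1)^-1 / 2.
  by field; apply/andP; split; rewrite gt_eqF//; lra.
apply: (@van_der_corput_step R x lam (E - 2)^-1 _ C 0 eta) => //; try lra.
- rewrite -[leLHS]mul1r ler_pdivrMr//.
  apply: (@le_trans _ _ (x ^+ 2 * x `^ (- 2 + eta))).
    rewrite -powR_mulrn ?(ltW x0)// -powRD; last first.
      by apply/implyP => _; rewrite gt_eqF.
    by rewrite -[leLHS](powRr0 x); apply: ler_powR => //; lra.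
  by rewrite ler_pM2l// exprn_gt0.
- by rewrite invr_gt0; lra.
- by rewrite -[leLHS]mul1r ler_pdivrMr; lra.
- by field; apply/andP; split; rewrite gt_eqF//; lra.
- move=> h r r0 hx; rewrite mul0r addr0.
  apply: IH => //; last exact: diff_class_shift.
  apply: le_trans lx _; rewrite ler_peMl ?ler1n// ltW//.
Qed.

(** * From the sawtooth to exponential sums *)

Definition sawtooth (R : realType) (y : R) : R :=
  y - (Num.floor y)%:~R - 1 / 2.

(* An antiderivative of [sawtooth], constant up to the second periodic
   Bernoulli polynomial. *)
Definition bern2 (R : realType) (y : R) : R :=
  ((y - (Num.floor y)%:~R) ^+ 2 - (y - (Num.floor y)%:~R)) / 2.

Lemma fract_itv (R : realType) (y : R) : 0 <= y - (Num.floor y)%:~R < 1.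
Proof.
have h1 := ge_floor y; have := lt_succ_floor y; rewrite intrD1 => h2.
by apply/andP; split; lra.
Qed.

(** The formula extends to the right endpoint because the polynomial vanishes at both 0 and 1. *)
Lemma bern2E (R : realType) (y : R) (z : int) : 0 <= y - z%:~R <= 1 ->
  bern2 y = ((y - z%:~R) ^+ 2 - (y - z%:~R)) / 2.
Proof.
move=> /andP[h0 h1]; have /andP[f0 f1] := fract_itv y.
have [h|h] := eqVneq (y - z%:~R) 1.
  have E : Num.floor y = z + 1.
    by apply: floor_def; rewrite !intrD1; apply/andP; split; lra.
  rewrite /bern2 E intrD1.
  have -> : y - (z%:~R + 1) = 0 by lra.
  by rewrite h; field.
have E : Num.floor y = z.
  apply: floor_def; rewrite intrD1; apply/andP; split; first lra.
  have : y - z%:~R < 1 by rewrite lt_neqAle h.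
  lra.
by rewrite /bern2 E.
Qed.

(** [sawtooth] has slope 1 and only downward jumps, so its mean over $[y,y+s]$, a difference
    quotient of [bern2], exceeds its value at $y$ by at most $s/2$. *)
Lemma sawtooth_ge (R : realType) (y s : R) : 0 < s -> s <= 1 ->
  (bern2 (y + s) - bern2 y) / s - s <= sawtooth y.
Proof.
move=> s0 s1; have /andP[f0 f1] := fract_itv y.
rewrite /sawtooth [bern2 y]/bern2.
move: (Num.floor y) f0 f1 => z f0 f1.
rewrite lerBlDr ler_pdivrMr//.
have [h|h] := leP (y + s - z%:~R) 1.
  rewrite (@bern2E _ _ z); last by apply/andP; split; lra.
  have -> : y + s - z%:~R = (y - z%:~R) + s by ring.
  move: (y - z%:~R) f0 f1 => f f0 f1; nra.
rewrite (@bern2E _ _ (z + 1)); last by rewrite intrD1; apply/andP; split; lra.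
have -> : y + s - (z + 1)%:~R = (y - z%:~R) + s - 1 by rewrite intrD1; ring.
have : 0 <= y - z%:~R + s - 1 by lra.
move: (y - z%:~R) f0 f1 => f f0 f1; nra.
Qed.

(** The mirror image of [sawtooth_ge], with the mean over $[y-s,y]$. *)
Lemma sawtooth_le (R : realType) (y s : R) : 0 < s -> s <= 1 ->
  sawtooth y <= (bern2 y - bern2 (y - s)) / s + s.
Proof.
move=> s0 s1; have /andP[f0 f1] := fract_itv y.
rewrite /sawtooth [bern2 y]/bern2.
move: (Num.floor y) f0 f1 => z f0 f1.
rewrite -lerBlDr ler_pdivlMr//.
have [h|h] := leP 0 (y - s - z%:~R).
  rewrite (@bern2E _ _ z); last by apply/andP; split; lra.
  have -> : y - s - z%:~R = (y - z%:~R) - s by ring.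
  move: (y - z%:~R) f0 f1 => f f0 f1; nra.
have E : (z - 1)%:~R = z%:~R - 1 :> R by rewrite intrB.
rewrite (@bern2E _ _ (z - 1)); last by rewrite E; apply/andP; split; lra.
have -> : y - s - (z - 1)%:~R = (y - z%:~R) - s + 1 by rewrite E; ring.
have : y - z%:~R - s < 0 by lra.
move: (y - z%:~R) f0 f1 => f f0 f1; nra.
Qed.

(** * Fourier approximation of the Bernoulli polynomial *)

Lemma dirichlet_kernel (R : realType) (al : R) (K : nat) :
  sin (al / 2) * (1 + 2 * \sum_(j < K) cos (j.+1%:R * al)) =
  sin (K%:R * al + al / 2).
Proof.
elim: K => [|K IH]; first by rewrite big_ord0 mulr0 addr0 mulr1 mul0r add0r.
rewrite big_ord_recr/= [2 * (_ + _)]mulrDr addrA [LHS]mulrDr IH.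
have -> : K%:R * al + al / 2 = K.+1%:R * al - al / 2.
  by rewrite -natr1; field.
by rewrite sinB sinD; ring.
Qed.

Lemma sin_natpi (R : realType) (r : nat) : sin (r%:R * pi) = 0 :> R.
Proof.
elim: r => [|r IH]; first by rewrite mul0r sin0.
by rewrite -natr1 mulrDl mul1r sinDpi IH oppr0.
Qed.

(* Both sides vanish at [r = 0], agree at [r = 1], and have second difference
   [-1] in [r]. *)
Lemma discrete_bern2 (R : realType) (K r : nat) : (r <= K.*2.+1)%N ->
  \sum_(j < K) (1 - cos (r%:R * (2 * pi * j.+1%:R / K.*2.+1%:R)))
    / (2 * sin (pi * (j.+1%:R / K.*2.+1%:R)) ^+ 2)
  = r%:R * (K.*2.+1%:R - r%:R) / 2 :> R.
Proof.
set T := K.*2.+1.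
have T0 : (0 : R) < T%:R by rewrite ltr0n.
have ET : T%:R = 2 * K%:R + 1 :> R by rewrite /T -natr1 -mul2n natrM.
pose th (j : nat) : R := 2 * pi * j.+1%:R / T%:R.
pose sn (j : nat) : R := sin (pi * (j.+1%:R / T%:R)).
have snpos (t : nat) : (0 < t)%N -> (t < T)%N -> (0 : R) < sin (pi * (t%:R / T%:R)).
  move=> t0 tT; apply: sin_gt0_pi; rewrite mulr_gt0 ?pi_gt0 ?divr_gt0 ?ltr0n//=.
  by rewrite gtr_pMr ?pi_gt0// ltr_pdivrMr// mul1r ltr_nat.
have sn0 (j : 'I_K) : sn j != 0.
  rewrite gt_eqF// snpos//.
  rewrite /T ltnS -addnn. exact: leq_trans (ltn_ord j) (leq_addr _ _).
pose h (r : nat) : R := \sum_(j < K) (1 - cos (r%:R * th j)) / (2 * sn j ^+ 2).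
have thE (j : nat) : cos (th j) = 1 - 2 * sn j ^+ 2.
  have -> : th j = (pi * (j.+1%:R / T%:R)) *+ 2 by rewrite mulr2n /th; field; rewrite gt_eqF.
  by rewrite cos_mulr2n /sn sin2cos2 mulr2n; ring.
have step m : (0 < m < T)%N -> h m.+1 = 2 * h m - h m.-1 - 1.
  case: m => // m /andP[_ mT].
  (* Since $K+1/2=T/2$, the kernel identity has right side $\sin((m+1)\pi)=0$. *)
  have D : \sum_(j < K) 2 * cos (m.+1%:R * th j) = -1.
    have := @dirichlet_kernel R (2 * pi * (m.+1%:R / T%:R)) K.
    have -> : 2 * pi * (m.+1%:R / T%:R) / 2 = pi * (m.+1%:R / T%:R) :> R.
      by field; rewrite gt_eqF.
    have -> : K%:R * (2 * pi * (m.+1%:R / T%:R)) + pi * (m.+1%:R / T%:R)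
        = m.+1%:R * pi :> R.
      have -> : K%:R = (T%:R - 1) / 2 :> R by rewrite ET; field.
      by field; rewrite gt_eqF.
    rewrite sin_natpi => /eqP; rewrite mulf_eq0 gt_eqF ?snpos//= => /eqP D.
    rewrite -mulr_sumr.
    have -> : \sum_(j < K) cos (m.+1%:R * th j) =
        \sum_(j < K) cos (j.+1%:R * (2 * pi * (m.+1%:R / T%:R))).
      by apply: eq_bigr => j _; congr cos; rewrite /th; field; rewrite gt_eqF.
    lra.
  have -> : h m.+2 = 2 * h m.+1 - h m.+1.-1 + \sum_(j < K) 2 * cos (m.+1%:R * th j).
    rewrite /h mulr_sumr -sumrB -big_split/=; apply: eq_bigr => j _.
    have -> : m.+2%:R * th j = m.+1%:R * th j + th j by rewrite -[m.+2%:R]natr1; ring.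
    have -> : m%:R * th j = m.+1%:R * th j - th j by rewrite -[m.+1%:R]natr1; ring.
    rewrite cosD cosB thE; field; exact: sn0.
  by rewrite D.
have hE m : (m <= T)%N -> h m = m%:R * (T%:R - m%:R) / 2.
  elim/ltn_ind: m => m IH; case: m IH => [|[|m]] IH mT.
  - rewrite mul0r mul0r /h big1// => j _; by rewrite mul0r cos0 subrr mul0r.
  - rewrite /h (eq_bigr (fun=> 1)); last first.
      move=> j _; rewrite mul1r thE opprB addrC subrK divff//.
      by rewrite mulf_neq0// expf_neq0// sn0.
    by rewrite sumr_const card_ord ET; field.
  rewrite step//= !IH//; try exact: ltnW; last by do 2!apply: ltnW.
  by rewrite -[m.+2%:R]natr1 -[m.+1%:R]natr1; field.
exact: hE.
Qed.

(** [discrete_bern2] is an exact Fourier expansion on the grid of step $1/T$, $T=2K+1$, with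
    coefficients bounded by $j^{-2}$ uniformly in [K]. A general [y] is compared with the grid point
    just below its fractional part. *)
Lemma bern2_fourier (R : realType) (eps : R) : 0 < eps ->
  exists (K : nat) (w : nat -> R) (c0 : R),
    (forall j, (j < K)%N -> 0 <= w j <= (j.+1%:R ^+ 2)^-1) /\
    forall y, `|bern2 y - (c0 + \sum_(j < K) w j * cos (2 * pi * (j.+1%:R * y)))|
      <= eps.
Proof.
(* The error will be at most $17/\sqrt T$: a share of 1 from the polynomial and 16 from the cosine
   sum. *)
move=> e0; pose K := (Num.truncn ((17 / eps) ^+ 2)).+1.
have KE : (17 / eps) ^+ 2 <= K%:R.
  by have /andP[_ /ltW] := truncn_itv (sqr_ge0 (17 / eps)).
pose T := K.*2.+1.
have T0 : (0 : R) < T%:R by rewrite ltr0n.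
pose w (j : nat) : R :=
  (2 * T%:R ^+ 2 * sin (pi * (j.+1%:R / T%:R)) ^+ 2)^-1.
have wb (j : nat) : (j < K)%N -> 0 <= w j <= (2 * j.+1%:R ^+ 2)^-1.
  move=> jK; have j0 : (0 : R) < j.+1%:R / T%:R by rewrite divr_gt0// ltr0n.
  have s1 : (j.+1%:R : R) / T%:R <= sin (pi * (j.+1%:R / T%:R)).
    apply: sin_pi_ge; first exact: ltW.
    rewrite lexx/= lerBrDr -mulrDl ler_pdivrMr// mul1r -natrD ler_nat /T.
    by rewrite -addnn; apply: leqW; apply: leq_add.
  have s2 : (j.+1%:R : R) <= T%:R * sin (pi * (j.+1%:R / T%:R)).
    by rewrite mulrC -ler_pdivrMr.
  have j1 : (0 : R) < j.+1%:R by rewrite ltr0n.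
  have -> : w j = (2 * (T%:R * sin (pi * (j.+1%:R / T%:R))) ^+ 2)^-1.
    by rewrite /w; congr (_^-1); ring.
  have j2 : (0 : R) < j.+1%:R ^+ 2 by exact: exprn_gt0.
  have s3 : (j.+1%:R : R) ^+ 2 <= (T%:R * sin (pi * (j.+1%:R / T%:R))) ^+ 2.
    by rewrite lerXn2r ?nnegrE//; lra.
  apply/andP; split; first by rewrite invr_ge0; lra.
  by rewrite lef_pV2 ?posrE; lra.
pose c0 : R := - \sum_(j < K) w j.
exists K, w, c0; split.
  move=> j jK; have /andP[-> wj] := wb j jK; apply: le_trans wj _ => /=.
  have j2 : (0 : R) < j.+1%:R ^+ 2 by rewrite exprn_gt0// ltr0n.
  by rewrite lef_pV2 ?posrE//; lra.
move=> y; have /andP[f0 f1] := fract_itv y.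
set z := Num.floor y in f0 f1; set f := y - z%:~R in f0 f1.
have /andP[r1 r2] := truncn_itv (mulr_ge0 (ltW T0) f0).
set r := Num.truncn (T%:R * f) in r1 r2.
pose g : R := r%:R / T%:R.
have gf : g <= f by rewrite /g ler_pdivrMr// mulrC.
have fg : f <= g + T%:R^-1.
  by rewrite /g -[X in _ + X]mul1r -mulrDl ler_pdivlMr// mulrC natr1 ltW.
have rT : (r <= T)%N.
  rewrite -(ler_nat R); apply: le_trans r1 _; rewrite ler_piMr// ltW//.
have g0 : 0 <= g by apply: divr_ge0 => //; exact: ltW.
have B1 : bern2 y = (f ^+ 2 - f) / 2 by [].
have B2 : (g ^+ 2 - g) / 2 = c0 + \sum_(j < K) w j * cos (2 * pi * (j.+1%:R * g)).
  have := @discrete_bern2 R K r rT; rewrite -/T => D.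
  have -> : (g ^+ 2 - g) / 2 = - (T%:R ^- 2 * (r%:R * (T%:R - r%:R) / 2)).
    by rewrite /g; field; rewrite gt_eqF.
  rewrite -D mulr_sumr /c0 -!sumrN -big_split/=; apply: eq_bigr => j _.
  have -> : 2 * pi * (j.+1%:R * g) = r%:R * (2 * pi * j.+1%:R / T%:R).
    by rewrite /g; field; rewrite gt_eqF.
  rewrite /w; set cc := cos _; set ss := sin _.
  have ss0 : ss != 0.
    rewrite gt_eqF//; apply: sin_gt0_pi.
    rewrite mulr_gt0 ?pi_gt0 ?divr_gt0 ?ltr0n//=.
    rewrite gtr_pMr ?pi_gt0// ltr_pdivrMr// mul1r ltr_nat /T ltnS -addnn.
    exact: leq_trans (ltn_ord j) (leq_addr _ _).
  by field; rewrite ss0 gt_eqF.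
have pi4 : pi < 4 :> R by have := pihalf_lt2 R; lra.
have p0 := pi_gt0 R.
have ti0 : 0 < T%:R^-1 :> R by rewrite invr_gt0.
have D1 : `|(f ^+ 2 - f) / 2 - (g ^+ 2 - g) / 2| <= T%:R^-1.
  have -> : (f ^+ 2 - f) / 2 - (g ^+ 2 - g) / 2 = (f - g) * ((f + g - 1) / 2).
    by field.
  rewrite normrM ger0_norm; last lra.
  have : `|(f + g - 1) / 2| <= 1 by rewrite ler_norml; apply/andP; split; lra.
  have : 0 <= `|(f + g - 1) / 2| by [].
  nra.
(* The $j$-th term moves by at most $\frac1{2j^2}\cdot\frac{8j}T$, and $\sum_{j\le K}1/j\le4\sqrt
   K$. *)
have D2 : `|\sum_(j < K) w j * cos (2 * pi * (j.+1%:R * y)) -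
    \sum_(j < K) w j * cos (2 * pi * (j.+1%:R * g))| <=
    16 * (Num.sqrt T%:R)^-1.
  rewrite -sumrB; apply: le_trans (ler_norm_sum _ _ _) _.
  apply: (@le_trans _ _ (\sum_(j < K) (4 * T%:R^-1) * (j.+1%:R)^-1)).
    apply: ler_sum => j _; rewrite -mulrBr normrM.
    have /andP[w0 wj] := wb j (ltn_ord j); rewrite (ger0_norm w0).
    have -> : cos (2 * pi * (j.+1%:R * y)) = cos (2 * pi * (j.+1%:R * f)).
      have -> : j.+1%:R * y = j.+1%:R * f + (j.+1%:Z * z)%:~R.
        by rewrite intrM -pmulrn /f; ring.
      by rewrite cosD_int.
    have j1 : (0 : R) < j.+1%:R by rewrite ltr0n.
    have c1 : `|cos (2 * pi * (j.+1%:R * f)) - cos (2 * pi * (j.+1%:R * g))| <=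
        8 * j.+1%:R * T%:R^-1.
      apply: le_trans (dist_cos _ _) _.
      have -> : 2 * pi * (j.+1%:R * f) - 2 * pi * (j.+1%:R * g) =
        (2 * j.+1%:R * pi) * (f - g) by ring.
      rewrite ger0_norm; last first.
        by apply: mulr_ge0; [apply: mulr_ge0; lra|lra].
      apply: ler_pM; [by apply: mulr_ge0; lra|lra| |lra].
      by rewrite mulrAC ler_pM2r//; lra.
    apply: le_trans (ler_pM w0 (normr_ge0 _) wj c1) _.
    by rewrite le_eqVlt; apply/orP; left; apply/eqP; field; rewrite !gt_eqF.
  rewrite -mulr_sumr.
  have h0 : (0 : R) < 2^-1 by lra.
  have h1 : (2^-1 : R) <= 1 by lra.
  have := sum_inv_le K h0 h1; rewrite powR12_sqrt// => S.
  have SK : Num.sqrt K%:R <= Num.sqrt T%:R :> R.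
    rewrite ler_wsqrtr// ler_nat /T -addnn; exact: leqW (leq_addr _ _).
  have sT0 : 0 < Num.sqrt T%:R :> R by rewrite sqrtr_gt0.
  have -> : 16 * (Num.sqrt T%:R)^-1 = 4 * T%:R^-1 * (4 * Num.sqrt T%:R) :> R.
    have : Num.sqrt T%:R ^+ 2 = T%:R :> R by rewrite sqr_sqrtr// ltW.
    move: sT0; set q := Num.sqrt _ => q0 <-; field; rewrite gt_eqF//.
  rewrite ler_pM2l; last by rewrite mulr_gt0.
  by apply: le_trans S _; rewrite invrK; lra.
have D3 : 17 * (Num.sqrt T%:R)^-1 <= eps.
  have sT : 17 / eps <= Num.sqrt T%:R.
    have h : 0 <= 17 / eps by apply: divr_ge0 => //; exact: ltW.
    rewrite -(ger0_norm h) -sqrtr_sqr ler_wsqrtr//; apply: le_trans KE _.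
    by rewrite ler_nat /T -addnn; exact: leqW (leq_addr _ _).
  rewrite ler_pdivrMr//; last by rewrite sqrtr_gt0.
  by rewrite mulrC -ler_pdivrMr.
have D4 : T%:R^-1 <= (Num.sqrt T%:R)^-1 :> R.
  rewrite lef_pV2 ?posrE ?sqrtr_gt0//.
  have h : 1 <= T%:R :> R by rewrite ler1n.
  have h2 : 1 <= Num.sqrt T%:R :> R by rewrite -[leLHS]sqrtr1 ler_wsqrtr.
  have : Num.sqrt T%:R ^+ 2 = T%:R :> R by rewrite sqr_sqrtr// ltW.
  nra.
rewrite B1; move: D1 D2; rewrite B2 !ler_norml; split_lra.
Qed.

(** Shifting by [s] turns each cosine into $-2\sin(\pi js)$ times a sine, and $|\sin(\pi
    js)|\le4\min(1,js)$; with the coefficients $j^{-2}$ this produces the weights. *)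
Lemma bern2_shift_sum (R : realType) (u : nat -> R) (L : nat) (s X eps : R)
    (A : nat -> R) : 0 < s -> 0 < eps ->
  (forall j phi, `|cosum (fun n => j.+1%:R * u n + phi) L| <= A j) ->
  (forall K, \sum_(j < K) Num.min 1 (j.+1%:R * s) / j.+1%:R ^+ 2 * A j <= X) ->
  `|\sum_(i < L) (bern2 (u i + s) - bern2 (u i))| <= 8 * X + 2 * eps * L%:R.
Proof.
move=> s0 e0 uA AX; have [K [w [c0 [wb wE]]]] := bern2_fourier e0.
pose P (y : R) : R := \sum_(j < K) w j * cos (2 * pi * (j.+1%:R * y)).
have A1 : `|\sum_(i < L) (bern2 (u i + s) - bern2 (u i)) -
    \sum_(i < L) (P (u i + s) - P (u i))| <= 2 * eps * L%:R.
  rewrite -sumrB; apply: le_trans (ler_norm_sum _ _ _) _.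
  have -> : 2 * eps * L%:R = \sum_(i < L) (2 * eps).
    by rewrite sumr_const card_ord -[RHS]mulr_natr.
  apply: ler_sum => i _; have := wE (u i + s); have := wE (u i).
  by rewrite -/(P _) -/(P _) !ler_norml; split_lra.
suff A2 : `|\sum_(i < L) (P (u i + s) - P (u i))| <= 8 * X.
  by move: A1 A2; rewrite !ler_norml; split_lra.
(* The phase shift $-1/4$ turns the cosine into the sine of the sum-to-product formula. *)
have -> : \sum_(i < L) (P (u i + s) - P (u i)) =
    \sum_(j < K) w j * (- 2 * sin (pi * (j.+1%:R * s)) *
      cosum (fun n => j.+1%:R * u n + (j.+1%:R * s / 2 - 1 / 4)) L).
  rewrite /cosum; under [RHS]eq_bigr => j _ do rewrite !mulr_sumr.
  rewrite exchange_big/=; apply: eq_bigr => i _.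
  rewrite /P -sumrB; apply: eq_bigr => j _; rewrite -mulrBr; congr (_ * _).
  have -> : 2 * pi * (j.+1%:R * u i + (j.+1%:R * s / 2 - 1 / 4)) =
    (2 * pi * (j.+1%:R * u i) + pi * (j.+1%:R * s)) - pi / 2 by field.
  rewrite cosBpihalf.
  have -> : 2 * pi * (j.+1%:R * (u i + s)) = (2 * pi * (j.+1%:R * u i) +
    pi * (j.+1%:R * s)) + pi * (j.+1%:R * s) by ring.
  have E : 2 * pi * (j.+1%:R * u i) = (2 * pi * (j.+1%:R * u i) +
    pi * (j.+1%:R * s)) - pi * (j.+1%:R * s) by ring.
  rewrite [X in _ - cos X]E cosD cosB; ring.
apply: le_trans (ler_norm_sum _ _ _) _.
apply: (@le_trans _ _ (8 * \sum_(j < K) Num.min 1 (j.+1%:R * s) / j.+1%:R ^+ 2 * A j)).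
  rewrite mulr_sumr; apply: ler_sum => j _.
  have /andP[w0 wj] := wb j (ltn_ord j).
  rewrite normrM (ger0_norm w0) !normrM normrN (ger0_norm (ler0n _ 2)).
  have j1 : (0 : R) < j.+1%:R by rewrite ltr0n.
  have js0 : 0 < j.+1%:R * s by exact: mulr_gt0.
  have p0 := pi_gt0 R.
  have pi4 : pi < 4 :> R by have := pihalf_lt2 R; lra.
  have m0 : 0 <= Num.min 1 (j.+1%:R * s) by rewrite le_min ler01/= ltW.
  have sm : `|sin (pi * (j.+1%:R * s))| <= 4 * Num.min 1 (j.+1%:R * s).
    rewrite minr_pMr// le_min; apply/andP; split.
      by apply: le_trans (sin_max _) _; lra.
    have := dist_sin (pi * (j.+1%:R * s)) 0; rewrite sin0 !subr0 => /le_trans; apply.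
    by rewrite ger0_norm ?mulr_ge0//; [rewrite ler_pM2r//; lra|lra|lra].
  have -> : 8 * (Num.min 1 (j.+1%:R * s) / j.+1%:R ^+ 2 * A j) =
    (j.+1%:R ^+ 2)^-1 * (2 * (4 * Num.min 1 (j.+1%:R * s)) * A j) by ring.
  apply: ler_pM => //.
  by apply: ler_pM => //; rewrite ?mulr_ge0// ler_pM2l.
by rewrite ler_pM2l//.
Qed.

Lemma sawtooth_sum (R : realType) (u : nat -> R) (L : nat) (s X : R)
    (A : nat -> R) : 0 < s -> s <= 1 ->
  (forall j phi, `|cosum (fun n => j.+1%:R * u n + phi) L| <= A j) ->
  (forall K, \sum_(j < K) Num.min 1 (j.+1%:R * s) / j.+1%:R ^+ 2 * A j <= X) ->
  `|\sum_(i < L) sawtooth (u i)| <= 2 * (s * L%:R) + 8 * (X / s).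
Proof.
(* With $\varepsilon=s^2/2$ the approximation error $2\varepsilon L$ becomes $sL$ after division by
   [s]. *)
move=> s0 s1 uA AX; have e0 : 0 < s ^+ 2 / 2 by rewrite divr_gt0// exprn_gt0.
have H1 := bern2_shift_sum s0 e0 uA AX.
(* The backward quotient replaces [u] by $u-s$, which only alters the constant phase. *)
have uA' j phi : `|cosum (fun n => j.+1%:R * (u n - s) + phi) L| <= A j.
  apply: le_trans (uA j (phi - j.+1%:R * s)).
  by rewrite le_eqVlt; apply/orP; left; apply/eqP; congr `|_|;
    apply: eq_cosum => n _; congr cos; ring.
have H2 := bern2_shift_sum s0 e0 uA' AX.
have sL (y : R) : \sum_(i < L) y = y * L%:R.
  by rewrite sumr_const card_ord -[LHS]mulr_natr.
have U1 : \sum_(i < L) (bern2 (u i + s) - bern2 (u i)) / s - s * L%:R <=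
    \sum_(i < L) sawtooth (u i).
  by rewrite -(sL s) -sumrB; apply: ler_sum => i _; exact: sawtooth_ge.
have U2 : \sum_(i < L) sawtooth (u i) <=
    \sum_(i < L) (bern2 (u i - s + s) - bern2 (u i - s)) / s + s * L%:R.
  rewrite -(sL s) -big_split; apply: ler_sum => i _; rewrite subrK.
  exact: sawtooth_le.
rewrite -!mulr_suml in U1 U2.
have E : (8 * X + 2 * (s ^+ 2 / 2) * L%:R) / s = 8 * (X / s) + s * L%:R.
  by field; rewrite gt_eqF.
have si : 0 < s^-1 by rewrite invr_gt0.
have N (y z : R) : `|y| <= z -> `|y / s| <= z / s.
  by rewrite normrM (gtr0_norm si) ler_pM2r.
move: (N _ _ H1) (N _ _ H2); rewrite E !ler_norml; split_lra.
Qed.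

(** * Weighted sums over the frequencies *)

Lemma sum_inv_sqr_le (R : realType) (K : nat) :
  \sum_(j < K) (j.+1%:R ^+ 2)^-1 <= 2 :> R.
Proof.
case: K => [|K]; first by rewrite big_ord0.
suff : \sum_(j < K.+1) (j.+1%:R ^+ 2)^-1 <= 2 - (K.+1%:R)^-1 :> R.
  by move=> /le_trans; apply; rewrite lerBlDr lerDl invr_ge0.
elim: K => [|K IH]; first by rewrite big_ord1 expr1n invr1; lra.
rewrite big_ord_recr/=; apply: le_trans (lerD IH (lexx _)) _.
have k0 : (0 : R) < K.+1%:R by rewrite ltr0n.
have -> : K.+2%:R = K.+1%:R + 1 :> R by rewrite natr1.
move: (K.+1%:R : R) k0 => t t0.
have : ((t + 1) ^+ 2)^-1 <= (t * (t + 1))^-1.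
  by rewrite lef_pV2 ?posrE; [nra|nra|nra].
have -> : (t * (t + 1))^-1 = t^-1 - (t + 1)^-1.
  by field; apply/andP; split; rewrite gt_eqF//; lra.
lra.
Qed.

(** Telescoping against $2/\sqrt t-2/\sqrt{t+1}$; the square roots $p\le q$ of $t$ and $t+1$ satisfy
    $(q-p)(q+p)=1$. *)
Lemma sum_powN32_tail (R : realType) (M K : nat) : (0 < M)%N ->
  \sum_(j < K) ((M + j).+1%:R * Num.sqrt (M + j).+1%:R)^-1
    <= 2 * (Num.sqrt M%:R)^-1 :> R.
Proof.
move=> M0; suff : \sum_(j < K) ((M + j).+1%:R * Num.sqrt (M + j).+1%:R)^-1
    <= 2 * (Num.sqrt M%:R)^-1 - 2 * (Num.sqrt (M + K)%:R)^-1 :> R.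
  by move=> /le_trans; apply; rewrite lerBlDr lerDl mulr_ge0// invr_ge0.
elim: K => [|K IH]; first by rewrite big_ord0 addn0 subrr.
rewrite big_ord_recr/=; apply: le_trans (lerD IH (lexx _)) _.
rewrite addnS.
have t0 : (0 : R) < (M + K)%:R by rewrite ltr0n addn_gt0 M0.
have -> : (M + K).+1%:R = (M + K)%:R + 1 :> R by rewrite natr1.
move: ((M + K)%:R : R) t0 => t t0.
have p0 : 0 < Num.sqrt t by rewrite sqrtr_gt0.
have q0 : 0 < Num.sqrt (t + 1) by rewrite sqrtr_gt0; lra.
have pE : Num.sqrt t ^+ 2 = t by rewrite sqr_sqrtr// ltW.
have qE : Num.sqrt (t + 1) ^+ 2 = t + 1 by rewrite sqr_sqrtr//; lra.
rewrite -[X in (X * _)^-1]qE.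
move: (Num.sqrt t) (Num.sqrt (t + 1)) p0 q0 pE qE => p q p0 q0 pE qE.
have pq : p <= q by rewrite -(@ler_pXn2r _ 2)// ?nnegrE; lra.
suff : (q ^+ 2 * q)^-1 <= 2 * (p^-1 - q^-1) by lra.
have -> : 2 * (p^-1 - q^-1) = 2 * (q - p) / (p * q).
  by field; rewrite !gt_eqF.
rewrite ler_pdivlMr; last exact: mulr_gt0.
rewrite mulrC ler_pdivrMr; last by rewrite mulr_gt0// exprn_gt0.
have d1 : (q - p) * (q + p) = 1 by rewrite -subr_sqr; lra.
have d2 : 1 <= (q - p) * (2 * q).
  by rewrite -[leLHS]d1 ler_wpM2l//; lra.
have -> : 2 * (q - p) * (q ^+ 2 * q) = (q - p) * (2 * q) * q ^+ 2 by ring.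
have q2 : 0 <= q ^+ 2 by exact: sqr_ge0.
nra.
Qed.

(** Split at $j\approx1/s$. Below, the minimum is bounded by $js$, and the sum of $j^{a-1}$ is
    $O(s^{-a})$. Above, it is bounded by 1, and $j^{a-2}\le s^{1/2-a}j^{-3/2}$ because $a\le1/2$. *)
Lemma sum_min_powR_le (R : realType) (a s : R) (K : nat) :
  0 < s -> s <= 1 -> 0 < a -> a <= 1 / 2 ->
  \sum_(j < K) Num.min 1 (j.+1%:R * s) / j.+1%:R ^+ 2 * j.+1%:R `^ a
    <= (2 / a + 3) * s `^ (1 - a).
Proof.
move=> s0 s1 a0 a2.
pose F (j : nat) : R := Num.min 1 (j.+1%:R * s) / j.+1%:R ^+ 2 * j.+1%:R `^ a.
have m0 (j : nat) : 0 <= Num.min 1 (j.+1%:R * s).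
  by rewrite le_min ler01/= mulr_ge0// ltW.
have F0 j : 0 <= F j by rewrite mulr_ge0 ?powR_ge0// divr_ge0// sqr_ge0.
have i1 : 1 <= s^-1 by rewrite -[leLHS]invr1 lef_pV2 ?posrE.
have si0 : 0 < s^-1 by lra.
have /andP[M1 M2] := truncn_itv (ltW si0).
case: (Num.truncn s^-1) M1 M2 => [|M'] M1 M2; first by lra.
set M := M'.+1 in M1 M2.
have MR : 1 <= M%:R :> R by rewrite ler1n.
apply: (@le_trans _ _ (\sum_(j < M + K) F j)).
  by rewrite addnC big_split_ord/= lerDl sumr_ge0.
rewrite big_split_ord/= mulrDl; apply: lerD.
  apply: (@le_trans _ _ (\sum_(j < M) s * j.+1%:R `^ (a - 1))).
    apply: ler_sum => j _.
    have j0 : (0 : R) < j.+1%:R by rewrite ltr0n.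
    rewrite powRB ?powRr1 ?(ltW j0)//; last first.
      by apply/implyP => _; rewrite gt_eqF.
    have -> : s * (j.+1%:R `^ a / j.+1%:R) = j.+1%:R * s / j.+1%:R ^+ 2 * j.+1%:R `^ a.
      by field; rewrite gt_eqF.
    rewrite /F ler_wpM2r ?powR_ge0// ler_wpM2r ?invr_ge0 ?sqr_ge0//.
    by rewrite ge_min lexx orbT.
  rewrite -mulr_sumr powRB ?powRr1 ?(ltW s0)//; last first.
    by apply/implyP => _; rewrite gt_eqF.
  have -> : 2 / a * (s / s `^ a) = s * (2 / a * (s^-1) `^ a).
    rewrite -[s^-1]powR_inv1 ?(ltW s0)// -powRrM mulN1r powRN; ring.
  apply: ler_wpM2l; first exact: ltW.
  apply: le_trans (sum_powR_le M a0 _) _; first lra.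
  apply: ler_wpM2l; first by apply: divr_ge0 => //; exact: ltW.
  by apply: ge0_ler_powR => //; rewrite ?nnegrE; lra.
apply: (@le_trans _ _ (\sum_(j < K)
    s `^ (1 / 2 - a) * ((M + j).+1%:R * Num.sqrt (M + j).+1%:R)^-1)).
  apply: ler_sum => j _; rewrite /F.
  have t1 : s^-1 <= (M + j).+1%:R.
    by apply: le_trans (ltW M2) _; rewrite ler_nat ltnS leq_addr.
  move: ((M + j).+1%:R : R) t1 => t t1.
  have t0 : 0 < t by lra.
  have ts : t^-1 <= s by rewrite -[leRHS]invrK lef_pV2 ?posrE.
  apply: (@le_trans _ _ (1 / t ^+ 2 * t `^ a)).
    rewrite ler_wpM2r ?powR_ge0// ler_wpM2r ?invr_ge0 ?sqr_ge0//.
    by rewrite ge_min lexx.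
  have E : t `^ a = Num.sqrt t * t^-1 `^ (1 / 2 - a).
    rewrite -powR12_sqrt ?(ltW t0)// -(powR_inv1 (ltW t0)) -powRrM -powRD.
      by congr (_ `^ _); lra.
    by apply/implyP => _; rewrite gt_eqF.
  have q0 : 0 < Num.sqrt t by rewrite sqrtr_gt0.
  have qE : Num.sqrt t ^+ 2 = t by rewrite sqr_sqrtr// ltW.
  have -> : 1 / t ^+ 2 * t `^ a = t^-1 `^ (1 / 2 - a) * (t * Num.sqrt t)^-1.
    rewrite E; move: q0 qE; move: (Num.sqrt t) (_ `^ _) => q w q0 <-.
    by field; rewrite gt_eqF.
  apply: ler_wpM2r; first by rewrite invr_ge0 mulr_ge0// ltW.
  apply: ge0_ler_powR => //; rewrite ?nnegrE; [lra|rewrite invr_ge0; lra|lra].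
rewrite -mulr_sumr.
have -> : 3 * s `^ (1 - a) = s `^ (1 / 2 - a) * (3 * Num.sqrt s).
  rewrite -powR12_sqrt ?(ltW s0)// mulrCA; congr (_ * _).
  rewrite -powRD; first by congr (_ `^ _); lra.
  by apply/implyP => _; rewrite gt_eqF.
apply: ler_wpM2l; first exact: powR_ge0.
apply: le_trans (sum_powN32_tail R K (isT : (0 < M)%N)) _.
have M3 : s^-1 <= 2 * M%:R by move: M2; rewrite -natr1; lra.
have q0 : 0 < Num.sqrt s by rewrite sqrtr_gt0.
have r0 : 0 < Num.sqrt M%:R :> R by rewrite sqrtr_gt0; lra.
have qE : Num.sqrt s ^+ 2 = s by rewrite sqr_sqrtr// ltW.
have rE : Num.sqrt M%:R ^+ 2 = M%:R :> R by rewrite sqr_sqrtr//; lra.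
have M4 : 1 <= 2 * (Num.sqrt M%:R * Num.sqrt s) ^+ 2.
  by rewrite exprMn qE rE mulrA -ler_pdivrMr// mul1r.
rewrite ler_pdivrMr//.
have := mulr_gt0 r0 q0; move: M4.
have -> : 3 * Num.sqrt s * Num.sqrt M%:R = 3 * (Num.sqrt M%:R * Num.sqrt s) by ring.
move: (_ * Num.sqrt s) => w; nra.
Qed.

Lemma sawtooth_sum_powR (R : realType) (u : nat -> R) (L : nat)
    (x s a C G lam : R) :
  0 < s -> s <= 1 -> 0 < a -> a <= 1 / 2 -> 0 <= C -> 0 <= G -> 0 < lam ->
  L%:R <= x ->
  (forall j phi, `|cosum (fun n => j.+1%:R * u n + phi) L| <=
     C * (x * (j.+1%:R * lam) `^ a + G / j.+1%:R)) ->
  `|\sum_(i < L) sawtooth (u i)| <=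
    2 * (s * x) + 8 * (C * (x * (lam `^ a * s `^ (- a)) * (2 / a + 3) + 2 * G)).
Proof.
move=> s0 s1 a0 a2 C0 G0 l0 Lx uA.
have x0 : 0 <= x by apply: le_trans Lx.
(* The two parts come from [sum_min_powR_le] and [sum_inv_sqr_le], the latter after bounding the
   minimum by $js$. *)
pose X := C * (x * lam `^ a * ((2 / a + 3) * s `^ (1 - a)) + 2 * (s * G)).
have AX K : \sum_(j < K) Num.min 1 (j.+1%:R * s) / j.+1%:R ^+ 2 *
    (C * (x * (j.+1%:R * lam) `^ a + G / j.+1%:R)) <= X.
  apply: (@le_trans _ _ (C * (x * lam `^ a * (\sum_(j < K)
      Num.min 1 (j.+1%:R * s) / j.+1%:R ^+ 2 * j.+1%:R `^ a) +
      s * G * \sum_(j < K) (j.+1%:R ^+ 2)^-1))).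
    rewrite !mulr_sumr -big_split/= mulr_sumr; apply: ler_sum => j _.
    have j0 : (0 : R) < j.+1%:R by rewrite ltr0n.
    rewrite powRM ?(ltW j0) ?(ltW l0)//.
    rewrite mulrCA; apply: ler_wpM2l => //; rewrite mulrDr; apply: lerD.
      by rewrite le_eqVlt; apply/orP; left; apply/eqP; ring.
    have -> : s * G * (j.+1%:R ^+ 2)^-1 = (j.+1%:R * s) / j.+1%:R ^+ 2 * (G / j.+1%:R).
      by field; rewrite gt_eqF.
    apply: ler_wpM2r; first exact: divr_ge0.
    apply: ler_wpM2r; first by rewrite invr_ge0 sqr_ge0.
    by rewrite ge_min lexx orbT.
  apply: ler_wpM2l => //; apply: lerD.
    by apply: ler_wpM2l; [rewrite mulr_ge0// powR_ge0|exact: sum_min_powR_le].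
  rewrite [leRHS]mulrC; apply: ler_wpM2l; first by rewrite mulr_ge0// ltW.
  exact: sum_inv_sqr_le.
apply: le_trans (sawtooth_sum s0 s1 uA AX) _.
apply: lerD; first by rewrite ler_pM2l// ler_pM2l.
rewrite ler_pM2l// le_eqVlt; apply/orP; left; apply/eqP.
rewrite /X powRB ?powRr1 ?(ltW s0)//; last by apply/implyP => _; rewrite gt_eqF.
have sa0 : 0 < s `^ a by exact: powR_gt0.
rewrite powRN; move: sa0; move: (s `^ a) (lam `^ a) => p q p0.
by field; rewrite !gt_eqF.
Qed.

(** * Finite differences of powers *)

(** The family [f] lists a function and its successive derivatives. The induction hypothesis is
    applied to $f_i(y+1)-f_i(y)$, and the mean value theorem on $[\xi,\xi+1]$ converts the remaining
    difference. *)
Lemma iter_fdiff_MVT (R : realType) (k : nat) (f : nat -> R -> R) (x : R)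
    (n : nat) :
  (forall i (y : R), 0 < y -> is_derive y 1 (f i) (f i.+1 y)) -> 0 < x ->
  exists xi : R, x + n%:R <= xi <= x + n%:R + k%:R /\
    iter k (@fdiff R) (fun m => f 0%N (x + m%:R)) n = f k xi.
Proof.
elim: k f => [|k IH] f df x0.
  by exists (x + n%:R); rewrite addr0 lexx.
pose g i y : R := f i (y + 1) - f i y.
have dg i (y : R) : 0 < y -> is_derive y 1 (g i) (g i.+1 y).
  move=> y0; have y1 : 0 < y + 1 by lra.
  apply: is_deriveB; last exact: df.
  rewrite -[f i.+1 (y + 1)]mulr1.
  apply: (@is_derive1_comp _ (f i) (fun z => z + 1)); first exact: df.
  exact: is_derive_shift.
have [xi [/andP[h1 h2] E]] := IH g dg x0.
have xi0 : 0 < xi by apply: lt_le_trans h1; rewrite ltr_wpDr.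
have cf : {within `[xi, xi + 1], continuous (f k)}%classic.
  apply: derivable_within_continuous => y; rewrite in_itv/= => /andP[y1 _].
  by have [] := df k y (lt_le_trans xi0 y1).
have df' y : y \in `]xi, xi + 1[ -> is_derive y 1 (f k) (f k.+1 y).
  by rewrite in_itv/= => /andP[y1 _]; apply: df; exact: lt_trans y1.
have [|z zI zE] := MVT _ df' cf; first by rewrite ltrDl.
have /andP[z1 z2] : xi < z < xi + 1 by move: zI; rewrite in_itv.
exists z; split.
  by rewrite -natr1; apply/andP; split; lra.
have -> : f k.+1 z = f k.+1 z * (xi + 1 - xi) by ring.
rewrite iterSr -zE -[RHS]/(g k xi) -E; congr (iter k _ _ n).
by apply/funext => m; rewrite /g /fdiff /= -natr1 addrA.
Qed.

Definition falling (R : realType) (c : R) (k : nat) : R :=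
  \prod_(j < k) (c - j%:R).

(** Non-integrality of [c] enters here: a vanishing factor would make [c] a natural number. *)
Lemma falling_neq0 (R : realType) (c : R) (k : nat) :
  c \isn't a Num.int -> falling c k != 0.
Proof.
move=> cZ; apply/prodf_neq0 => j _; apply/negP => /eqP E.
by move/negP: cZ; apply; have -> : c = j%:R by lra; rewrite natr_int.
Qed.

Lemma iter_fdiff_powR (R : realType) (c X ka phi : R) (k n : nat) :
  (0 < k)%N -> 0 < X ->
  exists xi : R, X + n%:R <= xi <= X + n%:R + k%:R /\
    iter k (@fdiff R) (fun m => ka * (X + m%:R) `^ c + phi) n
      = falling c k * (ka * xi `^ (c - k%:R)).
Proof.
move=> k0 X0.
(* The constant [phi] sits in the zeroth function only, since differentiation removes it. *)
pose f (i : nat) (y : R) : R :=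
  falling c i * ka * y `^ (c - i%:R) + (if i is 0%N then phi else 0).
have df i (y : R) : 0 < y -> is_derive y 1 (f i) (f i.+1 y).
  move=> y0; have -> : f i.+1 y = (falling c i * ka) *: ((c - i%:R) * y `^ (c - i%:R - 1)) + 0.
    rewrite /f/= /falling big_ord_recr/= -natr1 opprD addrA.
    by rewrite /GRing.scale/=; ring.
  by apply: is_deriveD; apply: is_deriveZ; exact: is_derive1_powR.
have [xi [h E]] := iter_fdiff_MVT k n df X0.
exists xi; split=> //.
have -> : falling c k * (ka * xi `^ (c - k%:R)) = f k xi.
  by rewrite /f; case: k k0 {h E} => // k _; rewrite addr0 mulrA.
rewrite -E; congr (iter k _ _ n); apply/funext => m.
by rewrite /f /falling big_ord0 mul1r subr0.
Qed.

(** Whatever the sign of the exponent, a power is bounded by the sum of its endpoint values; the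
    lower bound is the inverse of this bound for $-p$. *)
Lemma powR_compact_bounds (R : realType) (p M : R) : 1 <= M ->
  exists l U : R, [/\ 0 < l, l <= U & forall t, 1 / 2 <= t <= M ->
    l <= t `^ p <= U].
Proof.
move=> M1.
have U0 (q t : R) : 1 / 2 <= t <= M -> t `^ q <= (1 / 2) `^ q + M `^ q.
  move=> /andP[t1 t2]; have t0 : 0 < t by lra.
  have [q0|q0] := leP 0 q.
    apply: (@le_trans _ _ (M `^ q)); last by rewrite lerDr powR_ge0.
    by apply: ge0_ler_powR => //; rewrite ?nnegrE; lra.
  apply: (@le_trans _ _ ((1 / 2) `^ q)); last by rewrite lerDl powR_ge0.
  have E (y : R) : y `^ q = (y `^ (- q))^-1 by rewrite powRN invrK.
  rewrite !E lef_pV2 ?posrE; try by apply: powR_gt0; lra.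
  by apply: ge0_ler_powR => //; rewrite ?nnegrE; lra.
have V0 : 0 < (1 / 2) `^ (- p) + M `^ (- p).
  by apply: addr_gt0; apply: powR_gt0; lra.
have B (t : R) : 1 / 2 <= t <= M ->
    ((1 / 2) `^ (- p) + M `^ (- p))^-1 <= t `^ p <= (1 / 2) `^ p + M `^ p.
  move=> tM; rewrite U0// andbT -[t `^ p]invrK -powRN lef_pV2 ?posrE//.
    exact: U0.
  by apply: powR_gt0; lra.
exists ((1 / 2) `^ (- p) + M `^ (- p))^-1, ((1 / 2) `^ p + M `^ p); split=> //.
  by rewrite invr_gt0.
have /B /andP[h1 h2] : 1 / 2 <= (1 : R) <= M by apply/andP; split; lra.
exact: le_trans h2.
Qed.

(** The intermediate point satisfies $x/2\le\xi\le(2+N+k)x$, so $\xi^{c-k}$ is comparable with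
    $x^{c-k}$; the sign is that of [falling c k]. *)
Lemma iter_fdiff_powR_bounds (R : realType) (c : R) (k N : nat) :
  c \isn't a Num.int -> (0 < k)%N ->
  exists l U s : R, [/\ 0 < l, l <= U, s = 1 \/ s = -1 &
    forall (x X ka phi : R) (n : nat), 1 <= x -> 0 < ka ->
    x / 2 <= X -> X <= x + 1 -> n%:R <= N%:R * x ->
    l * (ka * x `^ (c - k%:R)) <=
    s * iter k (@fdiff R) (fun m => ka * (X + m%:R) `^ c + phi) n <=
    U * (ka * x `^ (c - k%:R))].
Proof.
move=> cZ k0; pose F := falling c k.
have F0 : 0 < `|F| by rewrite normr_gt0 falling_neq0.
have [|l [U [l0 lU lt]]] := @powR_compact_bounds R (c - k%:R) (2 + N%:R + k%:R).
  have : 0 <= N%:R :> R by []. have : 0 <= k%:R :> R by []. lra.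
exists (`|F| * l), (`|F| * U), (Num.sg F); split.
- exact: mulr_gt0.
- by rewrite ler_pM2l.
- by have [h|h|h] := ltgtP F 0;
    [right; rewrite ltr0_sg|left; rewrite gtr0_sg|move: F0; rewrite h normr0 ltxx].
move=> x X ka phi n x1 ka0 Xx xX nx.
have X0 : 0 < X by lra.
have [xi [/andP[h1 h2] ->]] := iter_fdiff_powR c ka phi n k0 X0.
have x0 : 0 < x by lra.
have n0 : 0 <= n%:R :> R by [].
have kR : 0 <= k%:R :> R by [].
have /lt /andP[b1 b2] : 1 / 2 <= xi / x <= 2 + N%:R + k%:R.
  rewrite ler_pdivlMr// ler_pdivrMr//; apply/andP; split; first lra.
  have : k%:R <= k%:R * x by rewrite ler_peMr.
  lra.
have xi0 : 0 < xi by lra.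
have -> : xi = x * (xi / x) by field; rewrite gt_eqF.
have t0 : 0 < xi / x by exact: divr_gt0.
rewrite powRM ?(ltW x0) ?(ltW t0)// -/F.
have p0 : 0 < x `^ (c - k%:R) by exact: powR_gt0.
move: (_ `^ _) (_ `^ _) b1 b2 p0 => w p b1 b2 p0.
have -> : Num.sg F * (F * (ka * (w * p))) = (`|F| * (ka * w)) * p.
  by rewrite normrEsg; ring.
have E y : `|F| * y * (ka * w) = (`|F| * (ka * w)) * y by ring.
by rewrite !E !ler_pM2l ?b1 ?mulr_gt0.
Qed.

Lemma diff_class_powR (R : realType) (c : R) (k : nat) :
  c \isn't a Num.int -> (2 <= k)%N ->
  exists b B : R, [/\ 0 < b, b <= B & forall x X ka phi : R,
    1 <= x -> 0 < ka -> x / 2 <= X -> X <= x + 1 ->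
    diff_class k b B x (ka * x `^ (c - k%:R))
      (fun n => ka * (X + n%:R) `^ c + phi)].
Proof.
case: k => [//|k] cZ k1.
have [l [U [s [l0 lU hs H]]]] := @iter_fdiff_powR_bounds R c k.+1 (2 * k.+1) cZ isT.
have [l' [U' [s' [l0' lU' hs' H']]]] := @iter_fdiff_powR_bounds R c k (2 * k.+1) cZ k1.
exists (Num.min l l'), (Num.max U U'); split.
- by rewrite lt_min l0.
- by rewrite le_max !ge_min lU.
move=> x X ka phi x1 ka0 Xx xX; exists s, s'; split=> // n nx.
have x0 : 0 < x by lra.
rewrite -natrM in nx.
have E : x * (ka * x `^ (c - k.+1%:R)) = ka * x `^ (c - k%:R).
  rewrite mulrCA -{1}(powRr1 (ltW x0)) -powRD; last first.
    by apply/implyP => _; rewrite gt_eqF.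
  by congr (_ * _ `^ _); rewrite -natr1; ring.
have p0 (m : nat) : 0 <= ka * x `^ (c - m%:R) by rewrite mulr_ge0 ?powR_ge0// ltW.
rewrite E; split.
  have /andP[h1 h2] := H x X ka phi n x1 ka0 Xx xX nx.
  apply/andP; split.
    by apply: le_trans h1; apply: ler_wpM2r => //; rewrite ge_min lexx.
  by apply: le_trans h2 _; apply: ler_wpM2r => //; rewrite le_max lexx.
have /andP[h1 h2] := H' x X ka phi n x1 ka0 Xx xX nx.
apply/andP; split.
  by apply: le_trans h1; apply: ler_wpM2r => //; rewrite ge_min lexx orbT.
by apply: le_trans h2 _; apply: ler_wpM2r => //; rewrite le_max lexx orbT.
Qed.

(** With $a=1/(2^k-2)$ and $e=1/(2^k-1)$ one has $a(1-e)=e$, so at $s=\lambda^e$ the smoothing error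
    $xs$ equals the contribution $x\lambda^as^{-a}$ of the exponential sums. *)
Lemma sawtooth_powR (R : realType) (c : R) (k : nat) :
  c \isn't a Num.int -> (2 <= k)%N ->
  exists C : R, 0 < C /\ forall (x q X phi lam : R) (L : nat),
    1 <= x -> 0 < q -> x / 2 <= X -> X <= x + 1 -> L%:R <= x ->
    lam = x `^ (c - k%:R) / q -> x `^ (- 2 + 2 / 2 ^+ k) <= lam -> lam <= 1 ->
    `|\sum_(i < L) sawtooth ((X + i%:R) `^ c / q + phi)| <=
      C * (x * lam `^ (2 ^+ k - 1)^-1).
Proof.
move=> cZ k2; have [b [B [b0 bB cls]]] := diff_class_powR cZ k2.
have K4 : 4 <= 2 ^+ k :> R by have := expn2B_gt0 R k2; lra.
pose a : R := (2 ^+ k - 2)^-1; pose e : R := (2 ^+ k - 1)^-1.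
have a0 : 0 < a by rewrite invr_gt0; lra.
have a2 : a <= 1 / 2 by rewrite -[a]mul1r ler_pdivrMr; lra.
have e0 : 0 < e by rewrite invr_gt0; lra.
have ea : a * (1 - e) = e.
  by rewrite /a /e; field; apply/andP; split; rewrite gt_eqF//; lra.
have eta1 : 2 / 2 ^+ k <= 1 :> R by rewrite ler_pdivrMr; lra.
have eta0 : 0 < 2 / 2 ^+ k :> R by rewrite divr_gt0//; lra.
(* One form for both tests: [G] is 0 for $k\ge3$ and $1/(x\lambda)$ for $k=2$. *)
have [C [C0 HC]] : exists C : R, 0 < C /\ forall (x q X phi lam : R) (L : nat),
    1 <= x -> 0 < q -> x / 2 <= X -> X <= x + 1 -> L%:R <= x ->
    lam = x `^ (c - k%:R) / q -> x `^ (- 2 + 2 / 2 ^+ k) <= lam ->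
    exists2 G : R, 0 <= G <= x * lam `^ e & forall (j : nat) phi',
    `|cosum (fun n => j.+1%:R * ((X + n%:R) `^ c / q + phi) + phi') L| <=
      C * (x * (j.+1%:R * lam) `^ a + G / j.+1%:R).
  have clsj x q X phi phi' lam (j : nat) :
      1 <= x -> 0 < q -> x / 2 <= X -> X <= x + 1 -> lam = x `^ (c - k%:R) / q ->
      diff_class k b B x (j.+1%:R * lam)
        (fun n => j.+1%:R * ((X + n%:R) `^ c / q + phi) + phi').
    move=> x1 q0 Xx xX ->.
    have := cls x X (j.+1%:R / q) (j.+1%:R * phi + phi') x1 _ Xx xX.
    have -> : j.+1%:R / q * x `^ (c - k%:R) = j.+1%:R * (x `^ (c - k%:R) / q) by ring.
    have -> : (fun n : nat => j.+1%:R / q * (X + n%:R) `^ c + (j.+1%:R * phi + phi'))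
        = (fun n : nat => j.+1%:R * ((X + n%:R) `^ c / q + phi) + phi').
      by apply/funext => n; ring.
    by apply; rewrite divr_gt0// ltr0n.
  have [k3|k3] := leqP 3 k.
    have [C [C0 HC]] := van_der_corput k3 b0 bB eta0 eta1.
    exists C; split=> // x q X phi lam L x1 q0 Xx xX Lx lE xl.
    have l0 : 0 < lam by apply: lt_le_trans xl; apply: powR_gt0; lra.
    exists 0; first by rewrite lexx mulr_ge0 ?powR_ge0//; lra.
    move=> j phi'; rewrite mul0r addr0; apply: HC => //; last exact: clsj.
    by apply: le_trans xl _; rewrite ler_peMl ?ler1n// ltW.
  have kE : k = 2%N by apply/eqP; rewrite eqn_leq k2 andbT -ltnS.
  subst k; have [C [C0 HC]] := van_der_corput2 b0 bB.
  exists C; split=> // x q X phi lam L x1 q0 Xx xX Lx lE xl.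
  have x0 : 0 < x by lra.
  have l0 : 0 < lam by apply: lt_le_trans xl; apply: powR_gt0.
  have lam0 : 0 < lam `^ e by exact: powR_gt0.
  have eE : e = 3^-1 by rewrite /e !exprS expr0; congr (_^-1); ring.
  have aE : a = 2^-1 by rewrite /a !exprS expr0; congr (_^-1); ring.
  exists (x * lam)^-1.
    rewrite invr_ge0 mulr_ge0 ?(ltW l0) ?(ltW x0)//=.
    rewrite -[leLHS]mul1r ler_pdivrMr ?mulr_gt0//.
    (* For $k=2$ the hypothesis $\lambda\ge x^{-3/2}$ says exactly $x^2\lambda^{4/3}\ge1$. *)
    have -> : x * lam `^ e * (x * lam) = x ^+ 2 * lam `^ (4 / 3).
      have -> : lam `^ (4 / 3) = lam `^ e * lam.
        rewrite -{3}(powRr1 (ltW l0)) -powRD; first by congr (_ `^ _); rewrite eE; field.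
        by apply/implyP => _; rewrite gt_eqF.
      ring.
    apply: (@le_trans _ _ (x ^+ 2 * (x `^ (- 2 + 2 / 2 ^+ 2)) `^ (4 / 3))).
      rewrite -powRrM -powR_mulrn ?(ltW x0)// -powRD; last first.
        by apply/implyP => _; rewrite gt_eqF.
      have -> : 2 + (- 2 + 2 / 2 ^+ 2) * (4 / 3) = 0 :> R.
        by rewrite !exprS expr0; field.
      by rewrite powRr0.
    rewrite ler_pM2l ?exprn_gt0//; apply: ge0_ler_powR => //;
      rewrite ?nnegrE ?powR_ge0 ?(ltW l0)//; lra.
  move=> j phi'.
  have -> : (x * lam)^-1 / j.+1%:R = (x * (j.+1%:R * lam))^-1.
    by rewrite -invfM; congr (_^-1); ring.
  rewrite aE powR12_sqrt; last by rewrite mulr_ge0// ltW.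
  apply: HC => //; first by rewrite mulr_gt0// ltr0n.
  exact: clsj.
exists (2 + 8 * (C * (2 / a + 5))); split.
  have : 0 < 2 / a by apply: divr_gt0.
  nra.
move=> x q X phi lam L x1 q0 Xx xX Lx lE xl l1.
have x0 : 0 < x by lra.
have l0 : 0 < lam by apply: lt_le_trans xl; apply: powR_gt0.
have [G /andP[G0 Gx] HG] := HC x q X phi lam L x1 q0 Xx xX Lx lE xl.
have s0 : 0 < lam `^ e by exact: powR_gt0.
have s1 : lam `^ e <= 1.
  rewrite -(powRr0 lam); apply: ger_powR; rewrite ?l0//; exact: ltW.
apply: le_trans (sawtooth_sum_powR s0 s1 a0 a2 (ltW C0) G0 l0 Lx HG) _.
have -> : lam `^ a * (lam `^ e) `^ (- a) = lam `^ e.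
  rewrite -powRrM -powRD; first by congr (_ `^ _); rewrite -[RHS]ea; ring.
  by apply/implyP => _; rewrite gt_eqF.
rewrite -/e; move: s0 Gx; move: (lam `^ e) => s s0 Gx.
have : C * (x * s * (2 / a + 3) + 2 * G) <= C * (x * s * (2 / a + 5)).
  by rewrite ler_pM2l//; lra.
have -> : (2 + 8 * (C * (2 / a + 5))) * (x * s) =
  2 * (s * x) + 8 * (C * (x * s * (2 / a + 5))) by ring.
lra.
Qed.

(** * Counting *)

Definition hit (R : realType) (c : R) (a q : int) (n : nat) : R :=
  ((Num.floor (n%:R `^ c : R) == a %[mod q])%Z : nat)%:R.

(** Write $\lfloor y\rfloor-a=mq+r$ with $0\le r<q$. The first floor is $m$, and subtracting $1/q$
    lowers it exactly when $r=0$. *)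
Lemma hit_floor (R : realType) (y : R) (a q : int) : 1 <= q ->
  ((Num.floor y == a %[mod q])%Z : nat)%:R =
    (Num.floor ((y - a%:~R) / q%:~R))%:~R -
    (Num.floor ((y - a%:~R - 1) / q%:~R))%:~R :> R.
Proof.
move=> q1; have q0 : (0 : R) < q%:~R by rewrite ltr0z; exact: lt_le_trans q1.
rewrite eqz_mod_dvd; set D := Num.floor y - a.
have /andP[f0 f1] := fract_itv y.
have DE : D%:~R = (Num.floor y)%:~R - a%:~R :> R by rewrite intrB.
have dE := divz_eq D q; have r0 := modz_ge0 D (lt0r_neq0 (lt_le_trans ltr01 q1)).
have rq := ltz_pmod D (lt_le_trans ltr01 q1).
rewrite -[(q %| D)%Z]/(D \in dvdz q) [in LHS]dvdz_eq.
move: dE r0 rq; set m := (D %/ q)%Z; set r := (D %% q)%Z => dE r0 rq.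
have dER : D%:~R = m%:~R * q%:~R + r%:~R :> R by rewrite -intrM -intrD -dE.
have r0R : (0 : R) <= r%:~R by rewrite ler0z.
have rqR : r%:~R <= q%:~R - 1 :> R.
  by rewrite lerBrDr -[1]/(1%:~R) -intrD ler_int lezD1.
have E1 : Num.floor ((y - a%:~R) / q%:~R) = m.
  apply: floor_def; rewrite intrD1 ler_pdivlMr// ltr_pdivrMr// mulrDl mul1r.
  by apply/andP; split; lra.
rewrite E1; have [/eqP r00|rn0] := boolP (m * q == D).
  have rz : r%:~R = 0 :> R by move: dER; rewrite -r00 intrM; lra.
  have -> : Num.floor ((y - a%:~R - 1) / q%:~R) = m - 1.
    apply: floor_def; rewrite subrK intrB ler_pdivlMr// ltr_pdivrMr// mulrBl mul1r.
    have : (1 : R) <= q%:~R by rewrite -[1]/(1%:~R) ler_int.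
    by move=> ?; apply/andP; split; lra.
  by rewrite intrB /=; ring.
have r1 : (1 : R) <= r%:~R.
  rewrite -[1]/(1%:~R) ler_int; have : r != 0.
    by apply: contraNneq rn0 => rz; rewrite [in X in _ == X]dE rz addr0.
  lia.
have -> : Num.floor ((y - a%:~R - 1) / q%:~R) = m.
  apply: floor_def; rewrite intrD1 ler_pdivlMr// ltr_pdivrMr// mulrDl mul1r.
  by apply/andP; split; lra.
by rewrite subrr.
Qed.

Lemma powR_succ_ge (R : realType) (c t : R) : 1 < c -> 0 <= t ->
  t `^ c + 1 <= (t + 1) `^ c.
Proof.
move=> c1 t0.
have t1 : 0 < t + 1 by lra.
have E (y : R) : 0 <= y -> y `^ c = y * y `^ (c - 1).
  by move=> y0; rewrite mulr_powRB1//; lra.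
rewrite !E//; last exact: ltW.
have h1 : t `^ (c - 1) <= (t + 1) `^ (c - 1).
  by apply: ge0_ler_powR; rewrite ?nnegrE; lra.
have h2 : 1 <= (t + 1) `^ (c - 1).
  by rewrite -[leLHS](powRr0 (t + 1)); apply: ler_powR; lra.
nra.
Qed.

Lemma hit_ge0 (R : realType) (c : R) (a q : int) (n : nat) : 0 <= hit c a q n.
Proof. exact: ler0n. Qed.

Lemma hit_le1 (R : realType) (c : R) (a q : int) (n : nat) : hit c a q n <= 1.
Proof. by rewrite /hit; case: eqP. Qed.

(* [n ^ c] grows by at least 1 at each step, so the indicator is dominated by
   the increments of [floor ((n ^ c - a) / q)]. *)
Lemma sum_hit_le (R : realType) (c : R) (a q : int) (m L : nat) :
  1 < c -> 1 <= q ->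
  \sum_(i < L) hit c a q (m + i).+1 <= (m + L)%:R `^ c / q%:~R + 1.
Proof.
move=> c1 q1; have q0 : (0 : R) < q%:~R by rewrite ltr0z; exact: lt_le_trans q1.
pose F (n : nat) : R := (Num.floor ((n%:R `^ c - a%:~R) / q%:~R))%:~R.
apply: (@le_trans _ _ (F (m + L)%N - F m)).
  elim: L => [|L IH]; first by rewrite big_ord0 addn0 subrr.
  rewrite big_ord_recr/=.
  have H : hit c a q (m + L).+1 <= F (m + L).+1 - F (m + L)%N.
    rewrite /hit hit_floor// lerD2l lerN2 ler_int; apply: le_floor.
    rewrite ler_pM2r ?invr_gt0// -natr1.
    have := @powR_succ_ge R c (m + L)%:R c1 (ler0n _ _); lra.
  by rewrite addnS; lra.
have /andP[h1 _] := fract_itv (((m + L)%:R `^ c - a%:~R) / q%:~R).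
have /andP[_ h2] := fract_itv ((m%:R `^ c - a%:~R) / q%:~R).
have h3 : 0 <= m%:R `^ c / q%:~R by rewrite divr_ge0 ?powR_ge0// ltW.
rewrite -/(F _) -/(F _) in h1 h2.
move: h1 h2; rewrite !mulrBl; lra.
Qed.

(** The error term of the theorem in the form $x\lambda^{1/(2^k-1)}$, convenient for comparing
    different [k]. *)
Definition block_main (R : realType) (c : R) (k : nat) (x : R) (q : int) : R :=
  x * (x `^ (c - k%:R) / q%:~R) `^ (2 ^+ k - 1)^-1.

Lemma block_mainE (R : realType) (c : R) (k : nat) (x : R) (q : int) :
  0 < x -> 1 <= q ->
  block_main c k x q = x `^ (1 - (k%:R - c) / (2 ^+ k - 1)) *
    q%:~R `^ (- (1 / (2 ^+ k - 1))).
Proof.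
move=> x0 q1; have q0 : (0 : R) < q%:~R by rewrite ltr0z; exact: lt_le_trans q1.
rewrite /block_main powRM ?powR_ge0 ?invr_ge0 ?(ltW q0)// mulrA.
rewrite -(powR_inv1 (ltW q0)) -!powRrM mul1r mulN1r; congr (_ * _).
rewrite -{1}(powRr1 (ltW x0)) -powRD; last by apply/implyP => _; rewrite gt_eqF.
by congr (_ `^ _); ring.
Qed.

Lemma leq_expn2B1 (R : realType) (k : nat) : (1 <= k)%N ->
  (1 : R) <= 2 ^+ k - 1 /\ k%:R <= 2 ^+ k - 1 :> R.
Proof.
case: k => // k _; elim: k => [|k [h1 h2]]; first by rewrite expr1; lra.
rewrite exprS -[k.+2%:R]natr1; lra.
Qed.

(** Induction on [k] for the block $x/2<n\le x$, by the size of $\lambda$: the trivial bound for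
    $\lambda\ge1$, the preceding [k] below the threshold of [sawtooth_powR], and that lemma in
    between. *)
Lemma block_estimate (R : realType) (c : R) (k : nat) :
  1 < c -> c \isn't a Num.int -> (1 <= k)%N ->
  exists C : R, 0 < C /\ forall (x : R) (a q : int),
    1 <= x -> 1 <= q -> q%:~R <= x `^ c ->
    `|\sum_(i < Num.truncn x - Num.truncn (x / 2))
        hit c a q (Num.truncn (x / 2) + i).+1 -
      (Num.truncn x - Num.truncn (x / 2))%:R / q%:~R|
    <= C * block_main c k x q.
Proof.
move=> c1 cZ; case: k => // k _.
have common (x : R) (q : int) : 1 <= x -> 1 <= q ->
   let L := (Num.truncn x - Num.truncn (x / 2))%N in
   [/\ (0 : R) < q%:~R, (1 : R) <= q%:~R, L%:R <= x, (L%:R : R) / q%:~R <= L%:R &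
      (Num.truncn (x / 2) + L)%:R <= x].
  move=> x1 q1 L; have q0 : (0 : R) < q%:~R by rewrite ltr0z; exact: lt_le_trans q1.
  have q1R : (1 : R) <= q%:~R by rewrite -[1]/(1%:~R) ler_int.
  have x0 : 0 <= x by lra.
  have /andP[t1 _] := truncn_itv x0.
  have ll : (Num.truncn (x / 2) <= Num.truncn x)%N by apply: le_truncn; lra.
  split=> //.
  - by apply: le_trans t1; rewrite ler_nat leq_subr.
  - by rewrite ler_pdivrMr// ler_peMr.
  - by rewrite subnKC.
elim: k => [|k [C [C0 IH]]].
  exists 2; split=> // x a q x1 q1 qx.
  have [q0 q1R Lx Lq mx] := common x q x1 q1.
  have x0 : 0 < x by lra.
  have -> : block_main c 1 x q = x `^ c / q%:~R.
    rewrite /block_main expr1; have -> : (2 - 1)^-1 = 1 :> R by rewrite addrK invr1.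
    rewrite powRr1; last by rewrite divr_ge0 ?powR_ge0// ltW.
    by rewrite mulrA mulr_powRB1//; lra.
  (* The hypothesis $q\le x^c$ absorbs the additive 1 of [sum_hit_le]. *)
  have h1 : 1 <= x `^ c / q%:~R by rewrite ler_pdivlMr// mul1r.
  have h2 : x <= x `^ c by apply: le1r_powR => //; exact: ltW.
  set m := Num.truncn (x / 2) in Lx Lq mx *.
  set L := (Num.truncn x - m)%N in Lx Lq mx *.
  have h3 := sum_hit_le a m L c1 q1.
  have h4 : (m + L)%:R `^ c / q%:~R <= x `^ c / q%:~R.
    rewrite ler_pM2r ?invr_gt0//; apply: ge0_ler_powR => //; rewrite ?nnegrE//; lra.
  have h5 : L%:R / q%:~R <= x `^ c / q%:~R.
    by rewrite ler_pM2r ?invr_gt0//; lra.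
  have h6 : 0 <= \sum_(i < L) hit c a q (m + i).+1.
    by apply: sumr_ge0 => i _; exact: hit_ge0.
  have h7 : 0 <= L%:R / q%:~R :> R by rewrite divr_ge0// ltW.
  by rewrite ler_norml; move: h1 h3 h4 h5 h6 h7; clear; split_lra.
have [C' [C0' HC']] := sawtooth_powR cZ (isT : (2 <= k.+2)%N).
exists (2 + C + 2 * C'); split; first lra.
move=> x a q x1 q1 qx.
have [q0 q1R Lx Lq mx] := common x q x1 q1.
have x0 : 0 < x by lra.
pose lam : R := x `^ (c - k.+2%:R) / q%:~R.
have l0 : 0 < lam by rewrite divr_gt0// powR_gt0.
pose e : R := (2 ^+ k.+2 - 1)^-1.
have e0 : 0 < e.
  by rewrite invr_gt0; have [+ _] := leq_expn2B1 R (isT : (1 <= k.+2)%N); lra.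
have ME : block_main c k.+2 x q = x * lam `^ e by [].
have M0 : 0 < x * lam `^ e by rewrite mulr_gt0// powR_gt0.
rewrite ME.
have [l1|l1] := leP 1 lam.
  have le1 : 1 <= lam `^ e.
    by rewrite -[leLHS](powRr0 lam); apply: ler_powR => //; exact: ltW.
  have xx : x <= x * lam `^ e by rewrite ler_peMr// ltW.
  set m := Num.truncn (x / 2) in Lx Lq mx *.
  set L := (Num.truncn x - m)%N in Lx Lq mx *.
  have h6 : 0 <= \sum_(i < L) hit c a q (m + i).+1.
    by apply: sumr_ge0 => i _; exact: hit_ge0.
  have h8 : \sum_(i < L) hit c a q (m + i).+1 <= L%:R.
    have -> : L%:R = \sum_(i < L) 1 :> R by rewrite sumr_const card_ord.
    by apply: ler_sum => i _; exact: hit_le1.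
  have h7 : 0 <= L%:R / q%:~R :> R by rewrite divr_ge0// ltW.
  have h9 : x <= (2 + C + 2 * C') * (x * lam `^ e) by nra.
  by rewrite ler_norml; move: h6 h7 h8 h9 Lx Lq; clear; split_lra.
have EK : 2 ^+ k.+2 = 2 * 2 ^+ k.+1 :> R by rewrite exprS.
have K2 : 2 <= 2 ^+ k.+1 :> R.
  by have [+ _] := leq_expn2B1 R (isT : (1 <= k.+1)%N); lra.
have [lx|lx] := ltP lam (x `^ (- 2 + 2 / 2 ^+ k.+2)).
  apply: le_trans (IH x a q x1 q1 qx) _.
  apply: (@le_trans _ _ (C * (x * lam `^ e))); last by rewrite ler_pM2r//; lra.
  apply: ler_wpM2l; first exact: ltW.
  apply: ler_wpM2l; first exact: ltW.
  have -> : x `^ (c - k.+1%:R) / q%:~R = x * lam.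
    rewrite /lam mulrA; congr (_ / _).
    rewrite -{2}(powRr1 (ltW x0)) -powRD; last by apply/implyP => _; rewrite gt_eqF.
    by congr (_ `^ _); rewrite -[k.+2%:R]natr1; ring.
  rewrite powRM ?(ltW x0) ?(ltW l0)//.
  pose K : R := 2 ^+ k.+1.
  rewrite -/K in EK K2 lx *; set d := (K - 1)^-1.
  have d0 : 0 < d by rewrite invr_gt0; lra.
  have dE : d = e + (d - e) by ring.
  have de : 0 <= d - e.
    rewrite subr_ge0 /d /e EK; move: K2; clear => K2.
    by rewrite lef_pV2 ?posrE; lra.
  have -> : lam `^ d = lam `^ e * lam `^ (d - e).
    by rewrite -powRD; [rewrite -dE|apply/implyP => _; rewrite gt_eqF].
  rewrite mulrCA ler_piMr ?powR_ge0//.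
  apply: (@le_trans _ _ (x `^ d * (x `^ (- 2 + 2 / 2 ^+ k.+2)) `^ (d - e))).
    rewrite ler_pM2l ?powR_gt0//; apply: ge0_ler_powR => //.
    - by rewrite nnegrE ltW.
    - by rewrite nnegrE powR_ge0.
    - exact: ltW.
  rewrite -powRrM -powRD; last by apply/implyP => _; rewrite gt_eqF.
  (* The threshold is the value of $\lambda$ at which the bounds for consecutive [k] coincide, so
     the exponents cancel. *)
  have -> : d + (- 2 + 2 / 2 ^+ k.+2) * (d - e) = 0.
    rewrite /d /e EK; move: K2; clear => K2.
    by field; apply/and3P; split; rewrite gt_eqF//; lra.
  by rewrite powRr0.
set m := Num.truncn (x / 2) in Lx Lq mx *.
set L := (Num.truncn x - m)%N in Lx Lq mx *.
(* The first integer above $x/2$; the block consists of the numbers $X+i$. *)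
pose X : R := m.+1%:R.
have x20 : 0 <= x / 2 by lra.
have /andP[m1 m2] := truncn_itv x20.
rewrite -/m in m1 m2.
have X1 : x / 2 <= X by exact: ltW.
have X2 : X <= x + 1 by rewrite /X -natr1; lra.
have P phi := HC' x q%:~R X phi lam L x1 q0 X1 X2 Lx erefl lx (ltW l1).
have P1 := P (- a%:~R / q%:~R).
have P2 := P (- (a%:~R + 1) / q%:~R).
(* By [hit_floor]: the linear parts of the two sawtooths differ by $1/q$, the expected density. *)
have -> : \sum_(i < L) hit c a q (m + i).+1 - L%:R / q%:~R =
    \sum_(i < L) sawtooth ((X + i%:R) `^ c / q%:~R + - (a%:~R + 1) / q%:~R) -
    \sum_(i < L) sawtooth ((X + i%:R) `^ c / q%:~R + - a%:~R / q%:~R).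
  have -> : L%:R / q%:~R = \sum_(i < L) (q%:~R)^-1 :> R.
    by rewrite sumr_const card_ord mulrC mulr_natr.
  rewrite -!sumrB; apply: eq_bigr => i _.
  rewrite /hit hit_floor//.
  have -> : (m + i).+1%:R = X + i%:R :> R by rewrite /X -natrD.
  rewrite /sawtooth -!mulrDl opprD addrA; move: (Num.floor _) (Num.floor _) => u v.
  by rewrite !mulrDl; ring.
rewrite -/e in P1 P2.
have CM : 0 < C * (x * lam `^ e) by exact: mulr_gt0.
have -> : (2 + C + 2 * C') * (x * lam `^ e) = 2 * (x * lam `^ e) +
  C * (x * lam `^ e) + 2 * (C' * (x * lam `^ e)) by ring.
move: P1 P2 CM M0; rewrite !ler_norml; clear; split_lra.
Qed.

(** * Summation over dyadic blocks *)

Lemma PS_count_hit (R : realType) (c x : R) (a q : int) :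
  (PS_count c x a q)%:R = \sum_(i < Num.truncn x) hit c a q i.+1 :> R.
Proof.
rewrite /PS_count big_mkcond/= big_add1/= big_mkord natr_sum.
by apply: eq_bigr => i _; rewrite /hit; case: ifP.
Qed.

(** The blocks are collected by repeated halving of [x]. The exponent [d] of [x] in the error is
    positive, so each halving multiplies the error by $w=2^{-d}<1$ and the errors form a geometric
    series. *)
Theorem theorem1p2 (R : realType) (c : R) (k : nat) :
  1 < c -> c \isn't a Num.int -> (1 <= k)%N ->
  exists C : R, 0 < C /\
    forall (x : R) (a q : int),
      1 <= x -> 1 <= q -> q%:~R <= x `^ c ->
      `| (PS_count c x a q)%:R - x / q%:~R | <=
        C * (x `^ (1 - (k%:R - c) / (2 ^+ k - 1))
             * q%:~R `^ (- (1 / (2 ^+ k - 1)))).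
Proof.
move=> c1 cZ k1; have [C1 [C10 HB]] := block_estimate c1 cZ k1.
have [K1 Kk] := leq_expn2B1 R k1.
pose d : R := 1 - (k%:R - c) / (2 ^+ k - 1).
have d0 : 0 < d.
  rewrite subr_gt0 ltr_pdivrMr; lra.
pose w : R := (1 / 2) `^ d.
have w0 : 0 < w by apply: powR_gt0; lra.
have one (p : R) : 1 `^ p = 1 by rewrite powR1.
have w1 : w < 1.
  by rewrite /w -[ltRHS](one d); apply: gt0_ltr_powR; rewrite ?nnegrE//; lra.
(* The solution of $C=Cw+C_1+4$: [C1] pays for the top block, 4 for rounding its length and for the
   last remainder. *)
pose C := (C1 + 4) / (1 - w).
have CE : C * w + (C1 + 4) = C by rewrite /C; field; rewrite gt_eqF//; lra.
have C0 : 0 < C by apply: divr_gt0; lra.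
exists C; split=> // x a q x1 q1.
(* The exponent [n] bounds the number of halvings and drives the induction. *)
have [n] : exists n : nat, x < 2 ^+ n.
  exists (Num.truncn x).+1; apply: lt_le_trans (truncnS_gt _) _.
  by rewrite -natrX ler_nat ltnW// ltn_expl.
elim: n x x1 => [|n IH] x x1 xn qx; first by move: xn; rewrite expr0; lra.
have x0 : 0 < x by lra.
have q0 : (0 : R) < q%:~R by rewrite ltr0z; exact: lt_le_trans q1.
have q1R : (1 : R) <= q%:~R by rewrite -[1]/(1%:~R) ler_int.
have HBx := HB x a q x1 q1 qx.
rewrite block_mainE// -/d in HBx.
set E := x `^ d * _ in HBx *.
(* From $q\le x^c$ follows $E\ge x^{1-k/(2^k-1)}\ge1$, so bounded errors are $O(E)$. *)
have E1 : 1 <= E.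
  have qe : (x `^ c) `^ (- (1 / (2 ^+ k - 1))) <= q%:~R `^ (- (1 / (2 ^+ k - 1))).
    rewrite !powRN lef_pV2 ?posrE ?powR_gt0//; apply: ge0_ler_powR => //.
    - by apply: divr_ge0; lra.
    - by rewrite nnegrE ltW.
    - by rewrite nnegrE powR_ge0.
  apply: (@le_trans _ _ (x `^ d * (x `^ c) `^ (- (1 / (2 ^+ k - 1))))); last first.
    by rewrite ler_pM2l// powR_gt0.
  rewrite -powRrM -powRD; last by apply/implyP => _; rewrite gt_eqF.
  rewrite -[leLHS](powRr0 x); apply: ler_powR => //.
  have -> : d + c * - (1 / (2 ^+ k - 1)) = 1 - k%:R / (2 ^+ k - 1).
    by rewrite /d; ring.
  by rewrite subr_ge0 ler_pdivrMr; lra.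
have m_le : (Num.truncn (x / 2) <= Num.truncn x)%N by apply: le_truncn; lra.
have SE : (PS_count c x a q)%:R = (PS_count c (x / 2) a q)%:R +
    \sum_(i < Num.truncn x - Num.truncn (x / 2))
      hit c a q (Num.truncn (x / 2) + i).+1 :> R.
  by rewrite !PS_count_hit -[in LHS](subnKC m_le) big_split_ord.
have LE : `|(Num.truncn x - Num.truncn (x / 2))%:R / q%:~R - (x - x / 2) / q%:~R| <= 1 :> R.
  rewrite -mulrBl normrM normfV (gtr0_norm q0) ler_pdivrMr// mul1r.
  apply: le_trans q1R; rewrite natrB//.
  have x20 : 0 <= x / 2 by lra.
  have /andP[a1 a2] := truncn_itv (ltW x0); have /andP[b1 b2] := truncn_itv x20.
  rewrite -[(Num.truncn x).+1%:R]natr1 in a2.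
  rewrite -[(Num.truncn (x / 2)).+1%:R]natr1 in b2.
  by rewrite ler_norml; move: a1 a2 b1 b2; clear; split_lra.
suff H : `|(PS_count c (x / 2) a q)%:R - x / 2 / q%:~R| <= C * w * E + 3 :> R.
  have CC : C * E = C * w * E + C1 * E + 4 * E by rewrite -[in LHS]CE; ring.
  move: H HBx LE E1; rewrite SE mulrBl CC !ler_norml; clear; split_lra.
have [qx2|qx2] := leP q%:~R ((x / 2) `^ c).
  have x21 : 1 <= x / 2.
    have [//|x2] := leP 1 (x / 2).
    have : (x / 2) `^ c < 1 by rewrite -[ltRHS](one c); apply: gt0_ltr_powR; rewrite ?nnegrE//; lra.
    lra.
  have xn2 : x / 2 < 2 ^+ n by move: xn; rewrite exprS; lra.
  apply: le_trans (IH (x / 2) x21 xn2 qx2) _.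
  have -> : (x / 2) `^ d = w * x `^ d.
    have -> : x / 2 = 1 / 2 * x by ring.
    by rewrite powRM//; lra.
  by rewrite -mulrA -/E mulrA; lra.
have CwE : 0 <= C * w * E.
  by apply: mulr_ge0; [apply: mulr_ge0; exact: ltW|lra].
have x20 : 0 <= x / 2 by lra.
have p1 : (PS_count c (x / 2) a q)%:R <= 2 :> R.
  rewrite PS_count_hit; have := sum_hit_le a 0 (Num.truncn (x / 2)) c1 q1.
  under eq_bigr do rewrite add0n.
  rewrite add0n => /le_trans; apply; rewrite -lerBrDr ler_pdivrMr//.
  have -> : (2 - 1) * q%:~R = q%:~R :> R by ring.
  apply: le_trans (ltW qx2); have /andP[b1 _] := truncn_itv x20.
  by apply: ge0_ler_powR => //; rewrite ?nnegrE//; lra.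
have p2 : x / 2 / q%:~R <= 1.
  rewrite ler_pdivrMr// mul1r; have [h|h] := leP 1 (x / 2); last lra.
  by apply: le_trans (ltW qx2); apply: le1r_powR => //; exact: ltW.
have p3 : 0 <= x / 2 / q%:~R by rewrite divr_ge0// ltW.
have p4 : 0 <= (PS_count c (x / 2) a q)%:R :> R by [].
by rewrite ler_norml; apply/andP; split; lra.
Qed.
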